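(* Let $S$ be a semigroup with a completely simple ideal $K$. (1) $S$ is solvable if and only if $S$ is a nilpotent extension of $K$ and every subgroup of $K$ is solvable. (2) The following are equivalent: $S$ is left nilpotent; $S$ is right nilpotent; $S$ is supernilpotent; $S$ is a nilpotent extension of $K$ and every subgroup of $K$ is nilpotent.
   Context: A semigroup is regarded as an algebra with one binary operation. For an algebra $\mathbf A$, $n\ge 1$ and congruences $\alpha_1,\dots,\alpha_n$, let $M_{\mathbf A}(\alpha_1,\dots,\alpha_n)$ be the subalgebra of $\mathbf A^{\{0,1\}^n}$ (functions $\{0,1\}^n\to A$, operations pointwise) generated by all functions $g$ for which there are $i\in\{1,\dots,n\}$ and $(a,b)\in\alpha_i$ with $g(x_1,\dots,x_n)=a$ if $x_i=0$ and $=b$ if $x_i=1$. The $n$-ary (term condition) commutator $[\alpha_1,\dots,\alpha_n]$ is the smallest congruence $\delta$ of $\mathbf A$ such that every $f\in M_{\mathbf A}(\alpha_1,\dots,\alpha_n)$ satisfies: if $(f(x0),f(x1))\in\delta$ for all $x\in\{0,1\}^{n-1}\setminus\{(1,\dots,1)\}$, then $(f(1,\dots,1,0),f(1,\dots,1,1))\in\delta$ (here $x0,x1$ denote $x$ with $0$, resp. $1$, appended). For $n=2$ this is the binary commutator $[\alpha,\beta]$. Let $1$ denote the total congruence $A^2$ and $0$ the equality relation. Define $[1]^0=1$, $[1]^{k+1}=[[1]^k,[1]^k]$; $(1]^1=1$, $(1]^{k+1}=[1,(1]^k]$; $[1)^1=1$, $[1)^{k+1}=[[1)^k,1]$. For $d\in\mathbb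 N=\{0,1,\dots\}$, $\mathbf A$ is $d$-solvable if $[1]^d=0$, left $d$-nilpotent if $(1]^{d+1}=0$, right $d$-nilpotent if $[1)^{d+1}=0$, $d$-supernilpotent if the $(d+1)$-ary commutator $[1,\dots,1]=0$; it is solvable (left nilpotent, right nilpotent, supernilpotent) if this holds for some $d$. For a semigroup $S$ and $m\ge1$, $S^m=\{a_1\cdots a_m: a_i\in S\}$. $S$ is a nilpotent extension of an ideal $K$ if $S^m\subseteq K$ for some $m\ge 1$. Solvability/nilpotence of groups is in the classical group-theoretic sense. *)

(* Defs.v *)
From Stdlib Require Import Arith.
Set Implicit Arguments.

Section Defs.
Variables (T : Type) (mul : T -> T -> T).

Definition rel := T -> T -> Prop.
Definition total_rel : rel := fun _ _ => True.

Definition congruence (R : rel) : Prop :=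
  (forall a, R a a) /\ (forall a b, R a b -> R b a) /\
  (forall a b c, R a b -> R b c -> R a c) /\
  (forall a b c d, R a b -> R c d -> R (mul a c) (mul b d)).

Definition is_zero (R : rel) : Prop := forall a b, R a b <-> a = b.

(* ---------- n-ary term condition commutator ----------
   Points of {0,1}^n are encoded as functions nat -> bool; only the
   coordinates 0..n-1 matter (every element of M depends only on them).
   alpha i is the i-th congruence (coordinate i, i < n). *)
Inductive inM (n : nat) (alpha : nat -> rel) : ((nat -> bool) -> T) -> Prop :=
  | inM_gen : forall i a b, i < n -> alpha i a b ->
      inM n alpha (fun x => if x i then b else a)
  | inM_mul : forall f g, inM n alpha f -> inM n alpha g ->
      inM n alpha (fun x => mul (f x) (g x)).

Definition app_last (n : nat) (x : nat -> bool) (b : bool) : nat -> bool :=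
  fun j => if Nat.eqb j (n - 1) then b else x j.

Definition all_ones : nat -> bool := fun _ => true.

Definition TC (n : nat) (alpha : nat -> rel) (delta : rel) : Prop :=
  forall f, inM n alpha f ->
    (forall x : nat -> bool, (exists j, j < n - 1 /\ x j = false) ->
        delta (f (app_last n x false)) (f (app_last n x true))) ->
    delta (f (app_last n all_ones false)) (f (app_last n all_ones true)).

Definition ncomm (n : nat) (alpha : nat -> rel) : rel :=
  fun a b => forall delta, congruence delta -> TC n alpha delta -> delta a b.

Definition comm2 (al be : rel) : rel :=
  ncomm 2 (fun i => if Nat.eqb i 0 then al else be).

Fixpoint derived_cong (k : nat) : rel :=
  match k with 0 => total_rel | S k' => comm2 (derived_cong k') (derived_cong k') end.
(* lcs k = (1]^(k+1) *)
Fixpoint lcs (k : nat) : rel :=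
  match k with 0 => total_rel | S k' => comm2 total_rel (lcs k') end.
(* rcs k = [1)^(k+1) *)
Fixpoint rcs (k : nat) : rel :=
  match k with 0 => total_rel | S k' => comm2 (rcs k') total_rel end.

Definition sg_solvable : Prop := exists d, is_zero (derived_cong d).
Definition sg_left_nilpotent : Prop := exists d, is_zero (lcs d).
Definition sg_right_nilpotent : Prop := exists d, is_zero (rcs d).
Definition sg_supernilpotent : Prop :=
  exists d, is_zero (ncomm (d + 1) (fun _ => total_rel)).

Definition is_ideal (K : T -> Prop) : Prop :=
  (exists k, K k) /\ forall s k, K k -> K (mul s k) /\ K (mul k s).

Definition simple_sub (K : T -> Prop) : Prop :=
  forall J : T -> Prop, (exists j, J j) -> (forall j, J j -> K j) ->
    (forall k j, K k -> J j -> J (mul k j) /\ J (mul j k)) ->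
    forall k, K k -> J k.

Definition idempotent (e : T) : Prop := mul e e = e.

Definition primitive_idempotent (K : T -> Prop) (e : T) : Prop :=
  K e /\ idempotent e /\
  forall f, K f -> idempotent f -> mul e f = f -> mul f e = f -> f = e.

Definition completely_simple_ideal (K : T -> Prop) : Prop :=
  is_ideal K /\ simple_sub K /\ exists e, primitive_idempotent K e.

Fixpoint inSm (m : nat) (z : T) : Prop :=
  match m with
  | 0 => False
  | S 0 => True
  | S m' => exists x y, inSm m' x /\ z = mul x y
  end.

Definition nilpotent_extension (K : T -> Prop) : Prop :=
  exists m, 1 <= m /\ forall z, inSm m z -> K z.

Definition subgroup (G : T -> Prop) (e : T) : Prop :=
  G e /\ (forall x y, G x -> G y -> G (mul x y)) /\
  (forall x, G x -> mul e x = x /\ mul x e = x) /\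
  (forall x, G x -> exists y, G y /\ mul x y = e /\ mul y x = e).

Definition is_inv (G : T -> Prop) (e x y : T) : Prop :=
  G y /\ mul x y = e /\ mul y x = e.

Inductive gen_sub (G : T -> Prop) (e : T) (A : T -> Prop) : T -> Prop :=
  | gs_gen : forall x, A x -> gen_sub G e A x
  | gs_one : gen_sub G e A e
  | gs_mul : forall x y, gen_sub G e A x -> gen_sub G e A y -> gen_sub G e A (mul x y)
  | gs_inv : forall x y, gen_sub G e A x -> is_inv G e x y -> gen_sub G e A y.

Definition comm_sub (G : T -> Prop) (e : T) (H1 H2 : T -> Prop) : T -> Prop :=
  gen_sub G e (fun z => exists x y x' y', H1 x /\ H2 y /\
     is_inv G e x x' /\ is_inv G e y y' /\ z = mul (mul x' y') (mul x y)).

Fixpoint derived_series (G : T -> Prop) (e : T) (k : nat) : T -> Prop :=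
  match k with
  | 0 => G
  | S k' => comm_sub G e (derived_series G e k') (derived_series G e k')
  end.

Fixpoint lower_central (G : T -> Prop) (e : T) (k : nat) : T -> Prop :=
  match k with
  | 0 => G
  | S k' => comm_sub G e (lower_central G e k') G
  end.

Definition group_solvable (G : T -> Prop) (e : T) : Prop :=
  exists k, forall z, derived_series G e k z -> z = e.

Definition group_nilpotent (G : T -> Prop) (e : T) : Prop :=
  exists k, forall z, lower_central G e k z -> z = e.

Definition subgroup_of (K G : T -> Prop) (e : T) : Prop :=
  subgroup G e /\ forall x, G x -> K x.

End Defs.

(* Main.v *)
(* If th_k is one of the iterated commutators of the total congruence, a product w of
   sufficiently many elements is th_k-related to w with an element of K inserted at some
   place; when th_k is equality this puts w in K. Group commutators x^-1 y^-1 x y witness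
   the term condition, which transfers solvability and nilpotence to the subgroups of K.

   Conversely, fix a primitive idempotent e of K and its group G = eKe. Every x in K is
   determined by its R-class, its L-class and exe in G. The iterated commutators first
   descend through the Rees congruences of S^j u K to that of K, then through the
   congruences identifying elements of K whose R- and L-classes agree after multiplication
   by any j factors, and finally through the congruences attached to the terms of the
   derived or lower central series of G. For supernilpotence, the R- and L-classes of a
   product depend only on its first and last m factors, and its G-coordinate is a product
   of G-valued functions each depending on at most m+1 of the n Boolean coordinates; for
   large n such a function satisfies the term condition because it is a polynomial map on
   the cube with respect to a filtration of the nilpotent group G. *)

From Stdlib Require Import Arith Lia List Bool ClassicalEpsilon FunctionalExtensionality.
Require Import Defs.
Set Implicit Arguments.

(** * Binary commutators through 2x2 matrices *)

Section Matrices.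
Variables (T : Type) (mul : T -> T -> T).

(* [sq al be a b c d] says that the matrix with rows (a, b) and (c, d), that is
   f(0,0), f(0,1) and f(1,0), f(1,1), belongs to M(al, be). *)
Inductive sq (al be : rel T) : T -> T -> T -> T -> Prop :=
  | sq_fst : forall a c, al a c -> sq al be a a c c
  | sq_snd : forall a b, be a b -> sq al be a b a b
  | sq_mul : forall a b c d a' b' c' d',
      sq al be a b c d -> sq al be a' b' c' d' ->
      sq al be (mul a a') (mul b b') (mul c c') (mul d d').

Definition TC2 (al be de : rel T) : Prop :=
  forall a b c d, sq al be a b c d -> de a b -> de c d.

Definition rel_le (R R' : rel T) : Prop := forall a b, R a b -> R' a b.

Lemma sq_mono al al' be be' a b c d :
  rel_le al al' -> rel_le be be' -> sq al be a b c d -> sq al' be' a b c d.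
Proof.
  intros Hal Hbe H; induction H.
  - apply sq_fst; auto.
  - apply sq_snd; auto.
  - apply sq_mul; auto.
Qed.

Lemma TC2_mono al al' be be' de :
  rel_le al al' -> rel_le be be' -> TC2 al' be' de -> TC2 al be de.
Proof. intros Hal Hbe H a b c d Hs; apply H; eapply sq_mono; eauto. Qed.

Lemma TC2_and al be de de' :
  TC2 al be de -> TC2 al be de' -> TC2 al be (fun a b => de a b /\ de' a b).
Proof. intros H H' a b c d Hs [H1 H2]; split; [eapply H | eapply H']; eauto. Qed.

Lemma sq_transpose al be a b c d : sq al be a b c d -> sq be al a c b d.
Proof.
  intros H; induction H.
  - apply sq_snd; auto.
  - apply sq_fst; auto.
  - apply sq_mul; auto.
Qed.

Lemma sq_rows al be a b c d :
  congruence mul be -> sq al be a b c d -> be a b /\ be c d.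
Proof.
  intros (Hr & Hs & Ht & Hm) H; induction H; [split; auto .. | ].
  destruct IHsq1, IHsq2; split; auto.
Qed.

Lemma sq_cols al be a b c d :
  congruence mul al -> sq al be a b c d -> al a c /\ al b d.
Proof. intros Hc H; apply sq_transpose in H; eapply sq_rows; eauto. Qed.

Lemma ncomm_congruence n al : congruence mul (ncomm mul n al).
Proof.
  split; [ | split; [ | split]].
  - intros a de (Hr & _) _; apply Hr.
  - intros a b H de Hde HT; apply (proj1 (proj2 Hde)); apply H; auto.
  - intros a b c H H' de Hde HT.
    apply (proj1 (proj2 (proj2 Hde))) with b; [apply H | apply H']; auto.
  - intros a b c d H H' de Hde HT.
    apply (proj2 (proj2 (proj2 Hde))); [apply H | apply H']; auto.
Qed.

Lemma ncomm_TC n al : TC mul n al (ncomm mul n al).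
Proof.
  intros f Hf Hx de Hde HTC; apply HTC; auto.
  intros x Hj; apply Hx; auto.
Qed.

Definition pair_fun (al be : rel T) : nat -> rel T :=
  fun i => if Nat.eqb i 0 then al else be.

Definition corner (u v : bool) : nat -> bool := fun j => if Nat.eqb j 0 then u else v.

(** Points of the cube are functions on all of [nat]; the last clause lets any point be replaced by
    the [corner] with the same first two coordinates. *)
Lemma sq_inM al be a b c d :
  sq al be a b c d -> exists f, inM mul 2 (pair_fun al be) f /\
    f (corner false false) = a /\ f (corner false true) = b /\
    f (corner true false) = c /\ f (corner true true) = d /\
    (forall x, f x = f (corner (x 0) (x 1))).
Proof.
  intros H; induction H.
  - exists (fun x : nat -> bool => if x 0 then c else a); repeat split.
    apply (@inM_gen T mul 2 (pair_fun al be) 0); auto.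
  - exists (fun x : nat -> bool => if x 1 then b else a); repeat split.
    apply (@inM_gen T mul 2 (pair_fun al be) 1); auto.
  - destruct IHsq1 as (f & Hf & Ha & Hb & Hc & Hd & Hx).
    destruct IHsq2 as (f' & Hf' & Ha' & Hb' & Hc' & Hd' & Hx').
    exists (fun x => mul (f x) (f' x)).
    repeat split; [apply inM_mul; auto | congruence .. | ].
    intros x; rewrite (Hx x), (Hx' x); reflexivity.
Qed.

Lemma inM_sq al be f :
  inM mul 2 (pair_fun al be) f ->
  sq al be (f (corner false false)) (f (corner false true))
     (f (corner true false)) (f (corner true true)) /\
  (forall x, f x = f (corner (x 0) (x 1))).
Proof.
  intros H; induction H as [i a b Hi Hab | f g Hf [IHf Hx] Hg [IHg Hx']].
  - destruct i as [|[|i]]; [ | | lia]; simpl in *; split; auto.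
    + apply sq_fst; auto.
    + apply sq_snd; auto.
  - split; [apply sq_mul; auto | ].
    intros x; rewrite (Hx x), (Hx' x); reflexivity.
Qed.

Lemma comm2_TC2 al be : TC2 al be (comm2 mul al be).
Proof.
  intros a b c d Hs Hab.
  destruct (sq_inM Hs) as (f & Hf & Ha & Hb & Hc & Hd & Hx).
  assert (H := @ncomm_TC 2 (pair_fun al be) f Hf).
  rewrite (Hx (app_last 2 all_ones false)), (Hx (app_last 2 all_ones true)) in H.
  unfold app_last, all_ones in H; simpl in H; rewrite Hc, Hd in H.
  apply H; intros x (j & Hj & Hxj).
  assert (j = 0) by lia; subst j.
  rewrite (Hx (fun j => if Nat.eqb j 1 then false else x j)),
    (Hx (fun j => if Nat.eqb j 1 then true else x j)).
  simpl; rewrite Hxj, Ha, Hb; exact Hab.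
Qed.

Lemma comm2_le al be de :
  congruence mul de -> TC2 al be de -> rel_le (comm2 mul al be) de.
Proof.
  intros Hde HTC a b Hab; apply Hab; auto.
  intros f Hf Hp.
  destruct (inM_sq Hf) as [Hs Hx].
  assert (H := HTC _ _ _ _ Hs).
  rewrite (Hx (app_last 2 all_ones false)), (Hx (app_last 2 all_ones true)).
  unfold app_last, all_ones; simpl; apply H.
  specialize (Hp (fun _ => false)).
  rewrite (Hx (app_last 2 (fun _ => false) false)), (Hx (app_last 2 (fun _ => false) true)) in Hp.
  apply Hp; exists 0; auto.
Qed.

(** The flags say which arguments of the commutator are iterated, so one descent argument serves the
    derived series and both lower series. *)
Fixpoint series (bl br : bool) (k : nat) : rel T :=
  match k with
  | 0 => @total_rel T
  | S k' => comm2 mul (if bl then series bl br k' else @total_rel T)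
                      (if br then series bl br k' else @total_rel T)
  end.

Lemma series_derived k : series true true k = derived_cong mul k.
Proof. induction k; simpl; congruence. Qed.
Lemma series_lcs k : series false true k = lcs mul k.
Proof. induction k; simpl; congruence. Qed.
Lemma series_rcs k : series true false k = rcs mul k.
Proof. induction k; simpl; congruence. Qed.

Lemma total_congruence : congruence mul (@total_rel T).
Proof. repeat split. Qed.

Lemma eq_congruence : congruence mul (@eq T).
Proof. repeat split; congruence. Qed.

Lemma series_congruence bl br k : congruence mul (series bl br k).
Proof. destruct k; [apply total_congruence | apply ncomm_congruence]. Qed.

Lemma is_zero_le (R : rel T) : congruence mul R -> rel_le R (@eq T) -> is_zero R.
Proof. intros [Hr _] H a b; split; [apply H | intros ->; apply Hr]. Qed.

Definition reaches (bl br : bool) (th : rel T) : Prop :=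
  exists k, rel_le (series bl br k) th.

Lemma reaches_total (bl br : bool) (th : rel T) : (forall a b, th a b) -> reaches bl br th.
Proof. intros H; exists 0; intros a b _; auto. Qed.

Lemma reaches_le (bl br : bool) (th th' : rel T) : rel_le th th' -> reaches bl br th -> reaches bl br th'.
Proof. intros H [k Hk]; exists k; intros a b Hab; auto. Qed.

Lemma reaches_step (bl br : bool) (th th' : rel T) :
  congruence mul th' ->
  TC2 (if bl then th else @total_rel T) (if br then th else @total_rel T) th' ->
  reaches bl br th -> reaches bl br th'.
Proof.
  intros Hc HT [k Hk]; exists (S k); simpl; apply comm2_le; auto.
  revert HT; apply TC2_mono; [destruct bl | destruct br]; auto; intros a b H; exact H.
Qed.

(** If both arguments are iterated, monotonicity shrinks the total congruence to [th], so the two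
    one-sided conditions cover all three series. *)
Lemma reaches_step_total (bl br : bool) (th th' : rel T) :
  bl || br = true -> congruence mul th' ->
  TC2 (@total_rel T) th th' -> TC2 th (@total_rel T) th' ->
  reaches bl br th -> reaches bl br th'.
Proof.
  intros Hb Hc H1 H2; apply reaches_step; auto.
  destruct bl, br; auto; [ | discriminate].
  revert H1; apply TC2_mono; intros a b; [constructor | auto].
Qed.

Lemma reaches_zero (bl br : bool) : reaches bl br (@eq T) -> exists d, is_zero (series bl br d).
Proof. intros [k Hk]; exists k; apply is_zero_le; auto; apply series_congruence. Qed.

(** In a product of two matrices, [th]-related rows make the lower row [th']-related outright;
    [th]-related columns link it to the upper row. *)
Lemma TC2_of_products (th th' : rel T) :
  congruence mul th -> congruence mul th' ->
  (forall a b c d, th a b -> th c d -> th' (mul a c) (mul b d)) ->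
  TC2 (@total_rel T) th th' /\ TC2 th (@total_rel T) th'.
Proof.
  intros Hc (Hr & Hs & Ht & _) H; split; intros a b c d Hsq Hab;
    destruct Hsq as [a c Hac | a b Hbe | a b c d a' b' c' d' H1 H2]; auto.
  - destruct (sq_rows Hc H1), (sq_rows Hc H2); auto.
  - destruct (sq_cols Hc H1), (sq_cols Hc H2).
    eapply Ht; [apply Hs | eapply Ht; [exact Hab | ]]; auto.
Qed.

End Matrices.

Arguments sq_fst {T mul al be} a c _.
Arguments sq_snd {T mul al be} a b _.

Lemma sq_opposite (T : Type) (mul : T -> T -> T) (al be : rel T) a b c d :
  sq mul al be a b c d -> sq (fun x y => mul y x) al be a b c d.
Proof.
  intros H; induction H.
  - apply sq_fst; auto.
  - apply sq_snd; auto.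
  - exact (sq_mul IHsq2 IHsq1).
Qed.

(** Transfers what is proved for R-classes to L-classes. *)
Lemma TC2_opposite (T : Type) (mul : T -> T -> T) (al be de : rel T) :
  TC2 (fun x y => mul y x) al be de -> TC2 mul al be de.
Proof. intros H a b c d Hs; apply H; apply sq_opposite; auto. Qed.

Lemma congruence_opposite (T : Type) (mul : T -> T -> T) (de : rel T) :
  congruence (fun x y => mul y x) de -> congruence mul de.
Proof. intros (Hr & Hs & Ht & Hm); repeat split; auto. Qed.

Lemma congruence_and (T : Type) (mul : T -> T -> T) (R R' : rel T) :
  congruence mul R -> congruence mul R' -> congruence mul (fun a b => R a b /\ R' a b).
Proof.
  intros (Hr & Hs & Ht & Hm) (Hr' & Hs' & Ht' & Hm'); split; [ | split; [ | split]].
  - auto.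
  - intros a b []; auto.
  - intros a b c [] []; eauto.
  - intros a b c d [] []; auto.
Qed.

(** * Products of generators and the coordinates they depend on *)

Definition depends (A : Type) (B : list nat) (F : (nat -> bool) -> A) : Prop :=
  forall x y, (forall i, In i B -> x i = y i) -> F x = F y.

Lemma fresh_index (B : list nat) n : length B < n -> exists i, i < n /\ ~ In i B.
Proof.
  intros HB; destruct (classic (exists i, i < n /\ ~ In i B)) as [H | H]; auto.
  assert (Hi : incl (seq 0 n) B).
  { intros i Hi; apply in_seq in Hi.
    destruct (in_dec Nat.eq_dec i B); auto.
    exfalso; apply H; exists i; split; [lia | auto]. }
  apply NoDup_incl_length in Hi; [ | apply seq_NoDup].
  rewrite length_seq in Hi; lia.
Qed.

(** Some coordinate [i < n] is missing from [B]. If it is the last one, both values agree outright;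
    otherwise setting it to 0 changes neither value, and the premise applies. *)
Lemma depends_TC (A : Type) (B : list nat) n (F : (nat -> bool) -> A) :
  depends B F -> length B < n ->
  (forall x, (exists j, j < n - 1 /\ x j = false) ->
     F (app_last n x false) = F (app_last n x true)) ->
  F (app_last n all_ones false) = F (app_last n all_ones true).
Proof.
  intros HB Hn Hp; destruct (fresh_index B Hn) as (i & Hi & Hin).
  destruct (Nat.eq_dec i (n - 1)) as [-> | Hne].
  - apply HB; intros j Hj; unfold app_last.
    destruct (Nat.eqb_spec j (n - 1)); auto; subst; contradiction.
  - assert (E : forall b, F (app_last n all_ones b) =
      F (app_last n (fun j => negb (Nat.eqb j i)) b)).
    { intros b; apply HB; intros j Hj; unfold app_last, all_ones.
      destruct (Nat.eqb j (n - 1)); auto.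
      destruct (Nat.eqb_spec j i); auto; subst; contradiction. }
    rewrite !E; apply Hp; exists i; split; [lia | ].
    rewrite Nat.eqb_refl; auto.
Qed.

Lemma filter_lt_le n B :
  length (filter (fun i => i <? n) B) <= length (filter (fun i => i <? S n) B).
Proof.
  induction B as [|i B IH]; simpl; auto.
  destruct (Nat.ltb_spec i n), (Nat.ltb_spec i (S n)); simpl; lia.
Qed.

Lemma filter_lt_In n B : In n B ->
  length (filter (fun i => i <? n) B) < length (filter (fun i => i <? S n) B).
Proof.
  induction B as [|i B IH]; simpl; [tauto | ].
  assert (H := filter_lt_le n B).
  intros [E | Hin]; [ | specialize (IH Hin)];
    destruct (Nat.ltb_spec i n), (Nat.ltb_spec i (S n)); simpl; lia.
Qed.

Section Words.
Variables (T : Type) (mul : T -> T -> T).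
Hypothesis assoc : forall x y z, mul x (mul y z) = mul (mul x y) z.
Variable n : nat.

(** Left-bracketed products of [r] generators of M. The congruences are forgotten: only the length
    and the coordinate of each generator matter later. *)
Inductive word : nat -> ((nat -> bool) -> T) -> Prop :=
  | word_one : forall i a b, i < n -> word 1 (fun x => if x i then b else a)
  | word_snoc : forall r f i a b, word r f -> i < n ->
      word (S r) (fun x => mul (f x) (if x i then b else a)).

Lemma word_mul r s f g : word r f -> word s g -> word (r + s) (fun x => mul (f x) (g x)).
Proof.
  intros Hf Hg; induction Hg as [i a b Hi | s g i a b Hg IH Hi].
  - rewrite Nat.add_1_r; apply word_snoc; auto.
  - rewrite Nat.add_succ_r.
    replace (fun x : nat -> bool => mul (f x) (mul (g x) (if x i then b else a)))
      with (fun x : nat -> bool => mul (mul (f x) (g x)) (if x i then b else a)).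
    + apply (word_snoc a b IH Hi).
    + apply functional_extensionality; intros x; auto.
Qed.

Lemma inM_word al f : inM mul n al f -> exists r, word r f.
Proof.
  intros H; induction H as [i a b Hi _ | f g _ [r Hr] _ [s Hs]].
  - exists 1; apply word_one; auto.
  - exists (r + s); apply word_mul; auto.
Qed.

Lemma word_split r s f : 1 <= r -> 1 <= s -> word (r + s) f ->
  exists u v, word r u /\ word s v /\ forall x, f x = mul (u x) (v x).
Proof.
  intros Hr Hs; revert f; induction Hs as [|s Hs IH]; intros f Hf.
  - rewrite Nat.add_1_r in Hf; inversion Hf; subst; [lia | ].
    exists f0, (fun x : nat -> bool => if x i then b else a); repeat split; auto; apply word_one; auto.
  - rewrite Nat.add_succ_r in Hf; inversion Hf; subst; [lia | ].
    destruct (IH f0 H0) as (u & v & Hu & Hv & E).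
    exists u, (fun x : nat -> bool => mul (v x) (if x i then b else a)); repeat split; auto.
    + apply word_snoc; auto.
    + intros x; rewrite E; auto.
Qed.

Lemma word_inSm r f x : word r f -> inSm mul r (f x).
Proof.
  intros H; induction H as [i a b Hi | r f i a b Hf IH Hi]; [exact I | ].
  destruct r; [inversion Hf | ]; simpl; eauto.
Qed.

Lemma word_depends r f : word r f -> exists B, length B <= r /\ depends B f.
Proof.
  intros H; induction H as [i a b Hi | r f i a b Hf (B & HB & Hd) Hi].
  - exists (i :: nil); split; auto; intros x y Hxy; rewrite (Hxy i); simpl; auto.
  - exists (i :: B); split; [simpl; lia | ].
    intros x y Hxy; rewrite (Hxy i), (Hd x y); simpl; auto.
    intros j Hj; apply Hxy; simpl; auto.
Qed.

End Words.

(** * Groups inside a semigroup *)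

Section Group.
Variables (T : Type) (mul : T -> T -> T).
Hypothesis assoc : forall x y z, mul x (mul y z) = mul (mul x y) z.
Variables (G : T -> Prop) (e : T).
Hypothesis HG : subgroup mul G e.

Local Infix "*" := mul.

Definition ginv (x : T) : T := epsilon (inhabits e) (is_inv mul G e x).

Lemma ginv_spec x : G x -> is_inv mul G e x (ginv x).
Proof. intros Hx; unfold ginv; apply epsilon_spec; apply HG; auto. Qed.

Lemma G_one : G e. Proof. apply HG. Qed.
Lemma G_mul x y : G x -> G y -> G (x * y). Proof. apply HG. Qed.
Lemma G_inv x : G x -> G (ginv x). Proof. intros H; apply (ginv_spec H). Qed.
Lemma mul1g x : G x -> e * x = x. Proof. apply HG. Qed.
Lemma mulg1 x : G x -> x * e = x. Proof. apply HG. Qed.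
Lemma mulgV x : G x -> x * ginv x = e. Proof. intros H; apply (ginv_spec H). Qed.
Lemma mulVg x : G x -> ginv x * x = e. Proof. intros H; apply (ginv_spec H). Qed.
Lemma mulKg x y : G x -> G y -> ginv x * (x * y) = y.
Proof. intros; rewrite assoc, mulVg, mul1g; auto. Qed.
Lemma mulVKg x y : G x -> G y -> x * (ginv x * y) = y.
Proof. intros; rewrite assoc, mulgV, mul1g; auto. Qed.
Lemma is_inv_ginv x y : G x -> is_inv mul G e x y -> y = ginv x.
Proof.
  intros Hx (Hy & Hxy & _).
  rewrite <- (mulKg Hx Hy), Hxy, mulg1; auto using G_inv.
Qed.
Lemma invMg x y : G x -> G y -> ginv (x * y) = ginv y * ginv x.
Proof.
  intros Hx Hy; symmetry; apply is_inv_ginv; [apply G_mul; auto | ].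
  assert (Hx' := G_inv Hx); assert (Hy' := G_inv Hy).
  split; [apply G_mul; auto | ]; rewrite <- !assoc, mulVKg, mulKg by auto using G_mul.
  rewrite mulgV, mulVg; auto.
Qed.
Lemma invgK x : G x -> ginv (ginv x) = x.
Proof.
  intros Hx; symmetry; apply is_inv_ginv; [apply G_inv; auto | ].
  repeat split; auto using mulgV, mulVg.
Qed.
Lemma invg1 : ginv e = e.
Proof. symmetry; apply is_inv_ginv; repeat split; auto using G_one, mul1g. Qed.

Ltac gin := repeat first [assumption | apply G_mul | apply G_inv | apply G_one].
Ltac group := repeat first
  [ rewrite <- assoc | rewrite invMg by gin | rewrite invgK by gin | rewrite invg1
  | rewrite mulKg by gin | rewrite mulVKg by gin | rewrite mulgV by gin
  | rewrite mulVg by gin | rewrite mul1g by gin | rewrite mulg1 by gin ]; auto.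

(** * Commutators, normal subgroups and the lower central series *)

Definition cm (x y : T) : T := (ginv x * ginv y) * (x * y).

Lemma G_cm x y : G x -> G y -> G (cm x y).
Proof. intros; unfold cm; gin. Qed.

Definition normal_subgroup (N : T -> Prop) : Prop :=
  (forall x, N x -> G x) /\ N e /\ (forall x y, N x -> N y -> N (x * y)) /\
  (forall x, N x -> N (ginv x)) /\
  (forall g x, G g -> N x -> N (ginv g * (x * g))).

Lemma full_normal : normal_subgroup G.
Proof. repeat split; intros; gin. Qed.

Lemma gen_sub_least (A N : T -> Prop) z :
  normal_subgroup N -> (forall x, A x -> N x) -> gen_sub mul G e A z -> N z.
Proof.
  intros (NG & N1 & NM & NV & NJ) HA H; induction H; auto.
  rewrite (is_inv_ginv (NG _ IHgen_sub) H0); auto.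
Qed.

Lemma gen_sub_normal (A : T -> Prop) :
  (forall x, A x -> G x) ->
  (forall g x, G g -> A x -> A (ginv g * (x * g))) ->
  normal_subgroup (gen_sub mul G e A).
Proof.
  intros AG AJ.
  assert (HsG : forall x, gen_sub mul G e A x -> G x).
  { intros x Hx; apply (gen_sub_least full_normal AG Hx). }
  split; [exact HsG | split; [ | split; [ | split]]].
  - apply gs_one.
  - intros x y; apply gs_mul.
  - intros x Hx; apply gs_inv with x; auto using ginv_spec.
  - intros g x Hg Hx; induction Hx.
    + apply gs_gen; auto.
    + rewrite mul1g, mulVg by auto; apply gs_one.
    + assert (G x) by auto; assert (G y) by auto.
      replace (ginv g * (x * y * g)) with ((ginv g * (x * g)) * (ginv g * (y * g)))
        by group.
      apply gs_mul; auto.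
    + assert (G x) by auto.
      apply gs_inv with (ginv g * (x * g)); auto.
      rewrite (is_inv_ginv H0 H).
      replace (ginv g * (ginv x * g)) with (ginv (ginv g * (x * g))) by group.
      apply ginv_spec; gin.
Qed.

Definition comm_gen (H1 H2 : T -> Prop) (z : T) : Prop :=
  exists x y x' y', H1 x /\ H2 y /\
     is_inv mul G e x x' /\ is_inv mul G e y y' /\ z = (x' * y') * (x * y).

Lemma comm_genP (H1 H2 : T -> Prop) z :
  (forall x, H1 x -> G x) -> (forall x, H2 x -> G x) ->
  comm_gen H1 H2 z <-> exists x y, H1 x /\ H2 y /\ z = cm x y.
Proof.
  intros h1 h2; split.
  - intros (x & y & x' & y' & Hx & Hy & Hx' & Hy' & ->); exists x, y; repeat split; auto.
    unfold cm; rewrite (is_inv_ginv (h1 _ Hx) Hx'), (is_inv_ginv (h2 _ Hy) Hy'); auto.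
  - intros (x & y & Hx & Hy & ->); exists x, y, (ginv x), (ginv y).
    repeat split; auto using ginv_spec, G_inv, mulgV, mulVg.
Qed.

Lemma comm_sub_normal (H1 H2 : T -> Prop) :
  normal_subgroup H1 -> normal_subgroup H2 ->
  normal_subgroup (comm_sub mul G e H1 H2).
Proof.
  intros N1 N2.
  destruct N1 as (G1 & _ & _ & _ & J1), N2 as (G2 & _ & _ & _ & J2).
  apply gen_sub_normal.
  - intros z Hz; apply (@comm_genP H1 H2 z G1 G2) in Hz.
    destruct Hz as (x & y & Hx & Hy & ->); apply G_cm; auto.
  - intros g z Hg Hz; apply (@comm_genP H1 H2 z G1 G2) in Hz.
    destruct Hz as (x & y & Hx & Hy & ->).
    apply (@comm_genP H1 H2 _ G1 G2).
    exists (ginv g * (x * g)), (ginv g * (y * g)); repeat split; auto.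
    assert (G x) by auto; assert (G y) by auto.
    unfold cm; group.
Qed.

Lemma comm_sub_cm (H1 H2 : T -> Prop) x y :
  (forall x, H1 x -> G x) -> (forall x, H2 x -> G x) ->
  H1 x -> H2 y -> comm_sub mul G e H1 H2 (cm x y).
Proof. intros G1 G2 Hx Hy; apply gs_gen; apply (@comm_genP H1 H2 _ G1 G2); eauto. Qed.

Lemma derived_normal k : normal_subgroup (derived_series mul G e k).
Proof. induction k; simpl; [apply full_normal | apply comm_sub_normal; auto]. Qed.

Lemma lower_central_normal k : normal_subgroup (lower_central mul G e k).
Proof.
  induction k; simpl; [apply full_normal | apply comm_sub_normal; auto using full_normal].
Qed.

Lemma lower_central_cm k x y :
  lower_central mul G e k x -> G y -> lower_central mul G e (S k) (cm x y).
Proof.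
  intros Hx Hy; apply comm_sub_cm; auto.
  apply (lower_central_normal k).
Qed.

Lemma cm_inv x y : G x -> G y -> ginv (cm x y) = cm y x.
Proof. intros; unfold cm; group. Qed.

Lemma lower_central_cm_sym k x y :
  G x -> lower_central mul G e k y -> lower_central mul G e (S k) (cm x y).
Proof.
  intros Hx Hy.
  assert (G y) by (apply (lower_central_normal k); auto).
  rewrite <- (cm_inv H Hx).
  apply (lower_central_normal (S k)); apply lower_central_cm; auto.
Qed.

Lemma lower_central_trivial_S k :
  (forall z, lower_central mul G e k z -> z = e) ->
  forall z, lower_central mul G e (S k) z -> z = e.
Proof.
  intros H z Hz.
  assert (Ht : normal_subgroup (fun z => z = e)).
  { repeat split; intros; subst; gin; group. }
  apply (gen_sub_least Ht) with (2 := Hz).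
  intros x Hx; apply comm_genP in Hx; [ | apply lower_central_normal | auto].
  destruct Hx as (u & v & Hu & Hv & ->); rewrite (H _ Hu); unfold cm; group.
Qed.

(** * Upper central series and left-normed commutators *)

Fixpoint upper_central (i : nat) (x : T) : Prop :=
  match i with
  | 0 => x = e
  | S i' => G x /\ forall y, G y -> upper_central i' (cm x y)
  end.

Lemma upper_central_normal i : normal_subgroup (upper_central i).
Proof.
  induction i as [|i IH]; simpl.
  - repeat split; intros; subst; gin; group.
  - destruct IH as (UG & U1 & UM & UV & UJ).
    split; [tauto | split; [ | split; [ | split]]].
    + split; gin; intros y Hy; replace (cm e y) with e; auto; unfold cm; group.
    + intros x x' [Hx H] [Hx' H']; split; gin; intros y Hy.
      replace (cm (x * x') y) with ((ginv x' * (cm x y * x')) * cm x' y).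
      * apply UM; auto.
      * unfold cm; group.
    + intros x [Hx H]; split; gin; intros y Hy.
      replace (cm (ginv x) y) with (ginv (ginv x) * (ginv (cm x y) * ginv x)).
      * apply UJ; gin; auto.
      * unfold cm; group.
    + intros g x Hg [Hx H]; split; gin; intros y Hy.
      replace (cm (ginv g * (x * g)) y)
        with (ginv g * (cm x (g * (y * ginv g)) * g)).
      * apply UJ; gin; apply H; gin.
      * unfold cm; group.
Qed.

(** Each commutation with [G] goes down one upper central term; [i] is kept free for the
    induction. *)
Lemma lower_central_upper_central k i :
  (forall x, G x -> upper_central (k + i) x) -> forall z, lower_central mul G e k z -> upper_central i z.
Proof.
  revert i; induction k as [|k IH]; simpl; intros i H z Hz; [apply H; auto | ].
  apply (gen_sub_least (upper_central_normal i)) with (2 := Hz).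
  intros x Hx; apply comm_genP in Hx; [ | apply lower_central_normal | auto].
  destruct Hx as (u & v & Hu & Hv & ->).
  apply (IH (S i)); auto.
  intros y Hy; rewrite Nat.add_succ_r; apply H; auto.
Qed.

Fixpoint left_normed (k : nat) (z : T) : Prop :=
  match k with
  | 0 => G z
  | S k' => exists c y, left_normed k' c /\ G y /\ z = cm c y
  end.

Lemma left_normed_G k z : left_normed k z -> G z.
Proof.
  revert z; induction k; simpl; auto.
  intros z (c & y & Hc & Hy & ->); apply G_cm; auto.
Qed.

(** The term condition will only give triviality of single left-normed commutators. Going down in
    [k], those with [k] brackets lie in the upper central term of index [n - k], so at [k = 0] all
    of [G] is the [n]-th term. *)
Lemma left_normed_nilpotent n :
  (forall z, left_normed n z -> z = e) -> group_nilpotent mul G e.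
Proof.
  intros H; exists n; intros z Hz.
  apply (@lower_central_upper_central n 0); auto.
  rewrite Nat.add_0_r.
  assert (Hu : forall i k, k + i = n -> forall x, left_normed k x -> upper_central i x).
  { induction i as [|i IH]; intros k Hk x Hx.
    - rewrite Nat.add_0_r in Hk; subst; simpl; auto.
    - split; [eapply left_normed_G; eauto | ].
      intros y Hy; apply (IH (S k)); [lia | ]; simpl; eauto. }
  intros x Hx; apply (Hu n 0); auto.
Qed.

(** * Commutators of group elements are commutators of congruences *)

Lemma congruence_kernel (de : rel T) :
  congruence mul de -> normal_subgroup (fun z => G z /\ de z e).
Proof.
  intros (Dr & Ds & Dt & Dm); split; [tauto | split; [ | split; [ | split]]].
  - split; gin; auto.
  - intros x y [] []; split; gin; rewrite <- (mul1g G_one); auto.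
  - intros x [Hx H]; split; gin; apply Ds.
    rewrite <- (mulVg Hx) at 1; rewrite <- (mulg1 (G_inv Hx)) at 2; auto.
  - intros g x Hg [Hx H]; split; gin.
    apply Dt with (ginv g * (e * g)); auto.
    replace (ginv g * (e * g)) with e by group; auto.
Qed.

(** In x^-1 y^-1 x y let x vary from [e] along [al] and y from [e] along [be]. Three entries of the
    resulting matrix are [e], the fourth is [cm x y]. The disjunction serves both orders of the
    arguments. *)
Lemma comm_sub_kernel (al be de : rel T) (H1 H2 : T -> Prop) z :
  congruence mul al -> congruence mul be -> congruence mul de ->
  TC2 mul al be de \/ TC2 mul be al de ->
  (forall x, H1 x -> G x /\ al x e) -> (forall y, H2 y -> G y /\ be y e) ->
  comm_sub mul G e H1 H2 z -> G z /\ de z e.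
Proof.
  intros Hal Hbe Hde HT h1 h2 Hz.
  apply (gen_sub_least (congruence_kernel Hde)) with (2 := Hz).
  intros w Hw; apply comm_genP in Hw; [ | apply h1 | apply h2].
  destruct Hw as (x & y & Hx & Hy & ->).
  destruct (h1 _ Hx) as [Gx ax], (h2 _ Hy) as [Gy ay].
  split; [apply G_cm; auto | ].
  assert (ax' : al (ginv x) e) by (apply (congruence_kernel Hal); auto).
  assert (ay' : be (ginv y) e) by (apply (congruence_kernel Hbe); auto).
  apply (proj1 (proj2 Hal)) in ax, ax'; apply (proj1 (proj2 Hbe)) in ay, ay'.
  apply (proj1 (proj2 Hde)).
  destruct HT as [HT | HT].
  - replace e with ((ginv x * e) * (x * e)) at 1 by group.
    refine (HT _ _ _ _ (sq_mul (sq_mul (sq_fst _ _ ax') (sq_snd _ _ ay'))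
      (sq_mul (sq_fst _ _ ax) (sq_snd _ _ ay))) _).
    replace ((e * ginv y) * (e * y)) with ((e * e) * (e * e)) by group; apply (proj1 Hde).
  - replace e with ((e * ginv y) * (e * y)) at 1 by group.
    refine (HT _ _ _ _ (sq_mul (sq_mul (sq_snd _ _ ax') (sq_fst _ _ ay'))
      (sq_mul (sq_snd _ _ ax) (sq_fst _ _ ay))) _).
    replace ((ginv x * e) * (x * e)) with ((e * e) * (e * e)) by group; apply (proj1 Hde).
Qed.

Lemma derived_series_kernel k z :
  derived_series mul G e k z -> G z /\ series mul true true k z e.
Proof.
  revert z; induction k as [|k IH]; simpl; intros z Hz; [split; [auto | exact I] | ].
  apply (@comm_sub_kernel (series mul true true k) (series mul true true k)) with (7 := Hz);
    auto using series_congruence, comm2_TC2.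
  apply ncomm_congruence.
Qed.

Lemma lower_central_kernel (b : bool) k z :
  lower_central mul G e k z -> G z /\ series mul b (negb b) k z e.
Proof.
  revert z; induction k as [|k IH]; simpl; intros z Hz; [split; [auto | exact I] | ].
  apply (@comm_sub_kernel (series mul b (negb b) k) (@total_rel T)) with (7 := Hz);
    auto using series_congruence, total_congruence.
  - apply ncomm_congruence.
  - destruct b; [left | right]; apply comm2_TC2.
  - intros y Hy; split; [auto | exact I].
Qed.

(** M is closed under products only, so the inverse [f'] is carried along: with [g] a new generator,
    f'g'fg and its inverse g'f'gf are both products. A single coordinate 0 makes [f] or [g] equal to
    [e], which kills the commutator. *)
Lemma left_normed_inM n k z : k < n -> left_normed k z ->
  exists f f', inM mul n (fun _ => @total_rel T) f /\ inM mul n (fun _ => @total_rel T) f' /\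
    (forall x, G (f x) /\ f' x = ginv (f x)) /\
    (forall x, (forall j, j <= k -> x j = true) -> f x = z) /\
    (forall x j, j <= k -> x j = false -> f x = e).
Proof.
  revert z; induction k as [|k IH]; simpl; intros z Hk Hz.
  - exists (fun x : nat -> bool => if x 0 then z else e),
      (fun x : nat -> bool => if x 0 then ginv z else e).
    split; [ | split; [ | split; [ | split]]].
    + apply (@inM_gen T mul n _ 0); [auto | exact I].
    + apply (@inM_gen T mul n _ 0); [auto | exact I].
    + intros x; destruct (x 0); split; gin; auto; rewrite invg1; auto.
    + intros x Hx; rewrite Hx; auto.
    + intros x j Hj Hx; replace j with 0 in Hx by lia; rewrite Hx; auto.
  - destruct Hz as (c & y & Hc & Hy & ->).
    destruct (IH c) as (f & f' & Mf & Mf' & HGf & H1 & H0); [lia | auto | ].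
    set (g := fun x : nat -> bool => if x (S k) then y else e).
    set (g' := fun x : nat -> bool => if x (S k) then ginv y else e).
    assert (Mg : inM mul n (fun _ => @total_rel T) g)
      by (apply (@inM_gen T mul n _ (S k)); [auto | exact I]).
    assert (Mg' : inM mul n (fun _ => @total_rel T) g')
      by (apply (@inM_gen T mul n _ (S k)); [auto | exact I]).
    assert (HGg : forall x, G (g x) /\ g' x = ginv (g x)).
    { intros x; unfold g, g'; destruct (x (S k)); split; gin; auto; rewrite invg1; auto. }
    exists (fun x => (f' x * g' x) * (f x * g x)), (fun x => (g' x * f' x) * (g x * f x)).
    split; [ | split; [ | split; [ | split]]].
    + repeat apply inM_mul; auto.
    + repeat apply inM_mul; auto.
    + intros x; destruct (HGf x) as [h1 E1], (HGg x) as [h2 E2].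
      rewrite E1, E2; split; gin; group.
    + intros x Hx; destruct (HGf x) as [h1 E1], (HGg x) as [h2 E2].
      rewrite E1, E2, H1 by auto; unfold g; rewrite Hx; auto.
    + intros x j Hj Hx; destruct (HGf x) as [h1 E1], (HGg x) as [h2 E2].
      rewrite E1, E2.
      destruct (Nat.eq_dec j (S k)) as [-> | Hne].
      * replace (g x) with e by (unfold g; rewrite Hx; auto); group.
      * rewrite (H0 x j) by (auto; lia); group.
Qed.

Lemma supernilpotent_group : sg_supernilpotent mul -> group_nilpotent mul G e.
Proof.
  intros [d Hd]; apply left_normed_nilpotent with d; intros z Hz.
  destruct (@left_normed_inM (d + 1) d z) as (f & f' & Mf & _ & _ & H1 & H0); auto; [lia | ].
  symmetry; apply (proj1 (Hd e z)).
  assert (H := @ncomm_TC T mul _ _ f Mf).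
  rewrite (H0 (app_last (d + 1) all_ones false) d),
    (H1 (app_last (d + 1) all_ones true)) in H; auto.
  - refine (H _); intros x (j & Hj & Hx).
    assert (E : forall b, f (app_last (d + 1) x b) = e).
    { intros b; apply H0 with j; [lia | ].
      unfold app_last; destruct (Nat.eqb_spec j (d + 1 - 1)); [lia | auto]. }
    rewrite !E; apply (proj1 (ncomm_congruence mul _ _)).
  - intros j _; unfold app_last, all_ones; destruct (Nat.eqb j (d + 1 - 1)); auto.
  - unfold app_last; rewrite Nat.add_sub, Nat.eqb_refl; auto.
Qed.

(** * Polynomial maps on cubes *)

Definition set_at (n : nat) (b : bool) (x : nat -> bool) : nat -> bool :=
  fun j => if Nat.eqb j n then b else x j.

Section Cubes.
Variable Gam : nat -> T -> Prop.
Hypothesis Gam_one : forall k, Gam k e.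
Hypothesis Gam_mul : forall k x y, Gam k x -> Gam k y -> Gam k (x * y).
Hypothesis Gam_inv : forall k x, Gam k x -> Gam k (ginv x).
Hypothesis Gam_le : forall k l x, k <= l -> Gam l x -> Gam k x.
Hypothesis Gam_cm : forall k l x y, Gam k x -> Gam l y -> Gam (k + l) (cm x y).

(* Maps on {0,1}^n whose iterated discrete derivatives in j distinct directions
   take values in Gam (k + j), cf. Host-Kra cubes of a filtered group. *)
Fixpoint poly (n k : nat) (F : (nat -> bool) -> T) : Prop :=
  match n with
  | 0 => forall x, Gam k (F x)
  | S n' => (forall x, G (F x)) /\ poly n' k (fun x => F (set_at n' false x)) /\
      poly n' (S k) (fun x => ginv (F (set_at n' false x)) * F (set_at n' true x))
  end.

Lemma poly_ext n k F F' : (forall x, F x = F' x) -> poly n k F -> poly n k F'.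
Proof. intros H; replace F' with F; auto; apply functional_extensionality; auto. Qed.

Lemma poly_le n k l F : k <= l -> poly n l F -> poly n k F.
Proof.
  revert k l F; induction n as [|n IH]; simpl; intros k l F Hkl H.
  - intros x; eapply Gam_le; eauto.
  - destruct H as (H1 & H2 & H3); repeat split; auto.
    + apply (IH k l); auto.
    + apply (IH (S k) (S l)); [lia | auto].
Qed.

Lemma poly_one n k : poly n k (fun _ => e).
Proof.
  revert k; induction n as [|n IH]; simpl; intros k; auto.
  repeat split; intros; gin; auto.
  apply poly_ext with (F := fun _ => e); auto; intros; group.
Qed.

(** Simultaneous induction, since derivatives mix the operations: with subscript 0 for the lower
    face, d(FH) = dF [dF, H0] dH, and d(F^-1) is the conjugate of (dF)^-1 by F0^-1. *)
Lemma poly_ops n :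
  (forall k F H, poly n k F -> poly n k H -> poly n k (fun x => F x * H x)) /\
  (forall k F, poly n k F -> poly n k (fun x => ginv (F x))) /\
  (forall k l F H, poly n k F -> poly n l H -> poly n (k + l) (fun x => cm (F x) (H x))).
Proof.
  induction n as [|n (IM & IV & IC)].
  { simpl; repeat split; intros; auto. }
  (* [F * cm F H] is the conjugate of [F] by [H]; the commutator has degree [k + l >= k]. *)
  assert (IJ : forall k F l H, poly n k F -> poly n l H ->
             poly n k (fun x => F x * cm (F x) (H x))).
  { intros k F l H HF HH; apply IM; auto.
    apply poly_le with (k + l); [lia | auto]. }
  split; [ | split].
  - intros k F H (FG & F0 & dF) (HG' & H0 & dH); simpl; repeat split.
    + intros; gin; auto.
    + apply (IM k _ _ F0 H0).
    + refine (@poly_ext n (S k) _ _ _ (IM _ _ _ (IJ _ _ _ _ dF H0) dH)).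
      intros x; simpl.
      assert (h1 := FG (set_at n false x)); assert (h2 := FG (set_at n true x)).
      assert (h3 := HG' (set_at n false x)); assert (h4 := HG' (set_at n true x)).
      unfold cm; group.
  - intros k F (FG & F0 & dF); simpl; repeat split.
    + intros; gin; auto.
    + apply (IV k _ F0).
    + refine (@poly_ext n (S k) _ _ _ (IJ _ _ _ _ (IV _ _ dF) (IV _ _ F0))).
      intros x; simpl.
      assert (h1 := FG (set_at n false x)); assert (h2 := FG (set_at n true x)).
      unfold cm; group.
  - intros k l F H (FG & F0 & dF) (HG' & H0 & dH); simpl; repeat split.
    + intros; apply G_cm; auto.
    + apply (IC k l _ _ F0 H0).
    (* With a = F0^-1 F1, b = H0^-1 H1, c = [F0,H0], t = [F1,b], s = [a,H0]:
       c^-1 [F1,H1] = t [t,c] [c,ab] s [s,b]. *)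
    + set (F0f := fun x => F (set_at n false x)) in *.
      set (H0f := fun x => H (set_at n false x)) in *.
      set (a := fun x => ginv (F (set_at n false x)) * F (set_at n true x)) in *.
      set (b := fun x => ginv (H (set_at n false x)) * H (set_at n true x)) in *.
      assert (Hc := IC _ _ _ _ F0 H0).
      assert (HF1 : poly n k (fun x => F0f x * a x)).
      { apply IM; auto; apply poly_le with (S k); auto. }
      assert (Ht : poly n (S (k + l)) (fun x => cm (F0f x * a x) (b x))).
      { rewrite <- Nat.add_succ_r; apply IC; auto. }
      assert (Hs : poly n (S (k + l)) (fun x => cm (a x) (H0f x))).
      { rewrite <- Nat.add_succ_l; apply IC; auto. }
      assert (Hab : poly n 1 (fun x => a x * b x)).
      { apply IM; [apply poly_le with (S k) | apply poly_le with (S l)]; auto; lia. }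
      assert (Hcab : poly n (S (k + l)) (fun x => cm (cm (F0f x) (H0f x)) (a x * b x))).
      { rewrite <- Nat.add_1_r; apply (IC (k + l) 1); auto. }
      refine (@poly_ext n (S (k + l)) _ _ _ (IM _ _ _ (IM _ _ _ (IJ _ _ _ _ Ht Hc) Hcab) (IJ _ _ _ _ Hs dH))).
      intros x; unfold F0f, H0f, a, b.
      assert (h1 := FG (set_at n false x)); assert (h2 := FG (set_at n true x)).
      assert (h3 := HG' (set_at n false x)); assert (h4 := HG' (set_at n true x)).
      unfold cm; group.
Qed.

Lemma poly_mul n k F H : poly n k F -> poly n k H -> poly n k (fun x => F x * H x).
Proof. apply poly_ops. Qed.

Definition ones_below (n : nat) (x : nat -> bool) : Prop := forall j, j < n -> x j = true.

(** Each lower face is trivial, so a derivative just restricts [F] to the upper face; after [n]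
    directions this is the value at the all-ones point. *)
Lemma poly_top n k F x :
  poly n k F -> (forall y, (exists j, j < n /\ y j = false) -> F y = e) ->
  ones_below n x -> Gam (k + n) (F x).
Proof.
  revert k F x; induction n as [|n IH]; simpl; intros k F x HF He Hx.
  - rewrite Nat.add_0_r; auto.
  - destruct HF as (FG & F0 & dF).
    assert (E : forall y, F (set_at n false y) = e).
    { intros y; apply He; exists n; split; auto; unfold set_at; rewrite Nat.eqb_refl; auto. }
    assert (D := IH _ _ x dF); simpl in D.
    rewrite E, invg1, mul1g in D by auto.
    replace (set_at n true x) with x in D.
    + rewrite Nat.add_succ_r; apply D.
      * intros y (j & Hj & Hy); rewrite E, invg1, mul1g by auto.
        apply He; exists j; split; [lia | ].
        unfold set_at; destruct (Nat.eqb_spec j n); [lia | auto].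
      * intros j Hj; apply Hx; lia.
    + apply functional_extensionality; intros j; unfold set_at.
      destruct (Nat.eqb_spec j n); auto; subst; rewrite Hx; auto.
Qed.

(** A derivative in a direction outside [B] is [e]; one in a direction in [B] raises [k] by one but
    uses up an entry of [B]. So [k] never exceeds [b], up to which [Gam k] is all of [G]. *)
Lemma poly_depends b B n k F :
  (forall k x, k <= b -> G x -> Gam k x) -> depends B F -> (forall x, G (F x)) ->
  k + length (filter (fun i => i <? n) B) <= b -> poly n k F.
Proof.
  intros Hb; revert k F; induction n as [|n IH]; simpl; intros k F HB FG Hk.
  - intros x; apply Hb; auto; lia.
  - assert (Hd : forall v, depends B (fun x => F (set_at n v x))).
    { intros v x y Hxy; apply HB; intros i Hi; unfold set_at.
      destruct (Nat.eqb i n); auto. }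
    assert (Hle := filter_lt_le n B).
    repeat split; auto.
    + apply IH; auto; lia.
    + destruct (in_dec Nat.eq_dec n B) as [Hin | Hin].
      * assert (Hlt := filter_lt_In n B Hin).
        apply IH; [ | intros; gin; auto | lia].
        intros x y Hxy; rewrite (Hd false x y Hxy), (Hd true x y Hxy); auto.
      * apply poly_ext with (F := fun _ => e); [ | apply poly_one].
        intros x; replace (F (set_at n true x)) with (F (set_at n false x)).
        -- rewrite mulVg; auto.
        -- apply HB; intros i Hi; unfold set_at.
           destruct (Nat.eqb_spec i n); auto; subst; contradiction.
Qed.

(** The premise makes the derivative in the last direction trivial off the all-ones point;
    [poly_top] then puts its remaining value in [Gam (1 + (n - 1))], which is trivial. *)
Lemma poly_TC n F :
  1 <= n -> (forall x, Gam n x -> x = e) -> poly n 0 F ->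
  (forall x, (exists j, j < n - 1 /\ x j = false) ->
     F (app_last n x false) = F (app_last n x true)) ->
  F (app_last n all_ones false) = F (app_last n all_ones true).
Proof.
  destruct n as [|n]; [lia | intros _ Ht (FG & F0 & dF) Hp].
  unfold app_last in *; rewrite Nat.sub_succ, Nat.sub_0_r in *.
  fold (set_at n false all_ones) (set_at n true all_ones).
  assert (E : ginv (F (set_at n false all_ones)) * F (set_at n true all_ones) = e).
  { apply Ht; apply (@poly_top n 1 _ all_ones dF).
    - intros y Hy; specialize (Hp y Hy).
      fold (set_at n false y) (set_at n true y) in Hp.
      rewrite <- Hp, mulVg; auto.
    - intros j _; reflexivity. }
  rewrite <- (mulVKg (x := F (set_at n false all_ones))
    (y := F (set_at n true all_ones))), E, mulg1; auto.
Qed.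

End Cubes.

(* The k-th term is the term of the lower central series of index about log_2 (k / b).
   As max(k, l) >= (k + l) / 2, the inclusion of the commutator of the k-th and l-th
   terms in the (k + l)-th is immediate, without the three subgroups lemma. *)
Definition log_filtration (b k : nat) (x : T) : Prop :=
  G x /\ forall j, (b * 2 ^ j)%nat < k -> lower_central mul G e (S j) x.

Lemma log_filtration_cm b k l x y :
  log_filtration b k x -> log_filtration b l y -> log_filtration b (k + l) (cm x y).
Proof.
  intros [Hx Hx'] [Hy Hy']; split; [apply G_cm; auto | ].
  intros [|j] Hj; [apply lower_central_cm; auto | ].
  destruct (le_lt_dec k (b * 2 ^ j)%nat) as [Hk | Hk].
  - apply lower_central_cm_sym; auto; apply Hy'.
    simpl in Hj; lia.
  - apply lower_central_cm; auto.
Qed.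

Definition cube_map (b n : nat) : ((nat -> bool) -> T) -> Prop :=
  poly (log_filtration b) n 0.

Lemma cube_map_mul b n F H :
  cube_map b n F -> cube_map b n H -> cube_map b n (fun x => F x * H x).
Proof.
  assert (N := lower_central_normal).
  apply poly_mul.
  - intros k x y [] []; split; [gin | ]; intros; apply (N (S j)); auto.
  - intros k x []; split; [gin | ]; intros; apply (N (S j)); auto.
  - intros k l x Hkl [Hx Hx']; split; auto; intros j Hj; apply Hx'; lia.
  - apply log_filtration_cm.
Qed.

(** For [k <= b] no [j] satisfies [b * 2 ^ j < k], so those terms of the filtration are all of
    [G]. *)
Lemma cube_map_depends b n B F :
  depends B F -> length B <= b -> (forall x, G (F x)) -> cube_map b n F.
Proof.
  intros HB Hb FG.
  assert (N := lower_central_normal).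
  apply poly_depends with (b := b) (B := B); auto.
  - intros k; split; [gin | ]; intros; apply (N (S j)).
  - intros k x Hk Hx; split; auto; intros j Hj.
    assert (1 <= 2 ^ j) by (apply Nat.neq_0_lt_0, Nat.pow_nonzero; lia).
    nia.
  - assert (H := filter_length_le (fun i => i <? n) B); simpl; lia.
Qed.

Lemma cube_map_TC b c n F :
  (forall z, lower_central mul G e c z -> z = e) -> (b * 2 ^ c)%nat < n ->
  cube_map b n F ->
  (forall x, (exists j, j < n - 1 /\ x j = false) ->
     F (app_last n x false) = F (app_last n x true)) ->
  F (app_last n all_ones false) = F (app_last n all_ones true).
Proof.
  intros Hc Hn HF; apply poly_TC with (Gam := log_filtration b); auto.
  - intros k; split; [gin | ]; intros; apply (lower_central_normal (S j)).
  - lia.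
  (* Taking [j = c] in the filtration gives the lower central term of index [c + 1]. *)
  - intros x [_ Hx]; apply (lower_central_trivial_S Hc); auto.
Qed.

End Group.

(** * Powers of a semigroup and Rees congruences *)

Section Powers.
Variables (T : Type) (mul : T -> T -> T).
Hypothesis assoc : forall x y z, mul x (mul y z) = mul (mul x y) z.

Local Infix "*" := mul.

Lemma inSm_succ m z : 1 <= m -> inSm mul (S m) z <-> exists x y, inSm mul m x /\ z = x * y.
Proof. destruct m; [lia | reflexivity]. Qed.

Lemma inSm_cons m s z : 1 <= m -> inSm mul m z -> inSm mul (S m) (s * z).
Proof.
  intros Hm; revert z; induction Hm as [|m Hm IH]; intros z Hz.
  - exists s, z; simpl; auto.
  - apply inSm_succ in Hz; auto; destruct Hz as (x & y & Hx & ->).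
    apply inSm_succ; [lia | ]; exists (s * x), y; split; auto.
Qed.

Lemma inSm_pred m z : 1 <= m -> inSm mul (S m) z -> inSm mul m z.
Proof.
  intros Hm; revert z; induction Hm as [|m Hm IH]; intros z Hz; [exact I | ].
  apply inSm_succ in Hz; [ | lia]; destruct Hz as (x & y & Hx & ->).
  apply inSm_succ; auto; exists x, y; split; auto.
Qed.

Lemma inSm_split m n z :
  1 <= m -> 1 <= n -> inSm mul (m + n) z ->
  exists x y, inSm mul m x /\ inSm mul n y /\ z = x * y.
Proof.
  intros Hm Hn; revert z; induction Hn as [|n Hn IH]; intros z Hz.
  - rewrite Nat.add_1_r in Hz; apply inSm_succ in Hz; auto.
    destruct Hz as (x & y & Hx & ->); exists x, y; simpl; auto.
  - rewrite Nat.add_succ_r in Hz; apply inSm_succ in Hz; [ | lia].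
    destruct Hz as (w & v & Hw & ->).
    destruct (IH _ Hw) as (x & y & Hx & Hy & ->).
    exists x, (y * v); repeat split; auto.
    apply inSm_succ; eauto.
Qed.

Definition rees (J : T -> Prop) (a b : T) : Prop := a = b \/ (J a /\ J b).

Lemma rees_congruence (J : T -> Prop) :
  (forall s z, J z -> J (s * z)) -> (forall s z, J z -> J (z * s)) ->
  congruence mul (rees J).
Proof.
  intros HJl HJr; split; [left; auto | split; [ | split]].
  - intros a b [-> | []]; [left | right]; auto.
  - intros a b c [-> | []] [-> | []]; [left | right ..]; auto.
  - intros a b c d [-> | []] [-> | []]; [left; auto | right; auto ..].
Qed.

Variable K : T -> Prop.
Hypothesis K_l : forall s k, K k -> K (s * k).
Hypothesis K_r : forall s k, K k -> K (k * s).

Definition layer (j : nat) (z : T) : Prop := K z \/ inSm mul j z.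

Lemma layer_l j s z : 1 <= j -> layer j z -> layer (S j) (s * z).
Proof. intros Hj [Hz | Hz]; [left; auto | right; apply inSm_cons; auto]. Qed.

Lemma layer_r j s z : 1 <= j -> layer j z -> layer (S j) (z * s).
Proof. intros Hj [Hz | Hz]; [left; auto | right; apply inSm_succ; eauto]. Qed.

Lemma layer_pred j z : 1 <= j -> layer (S j) z -> layer j z.
Proof. intros Hj [Hz | Hz]; [left; auto | right; apply inSm_pred; auto]. Qed.

Lemma layer_congruence j : 1 <= j -> congruence mul (rees (layer j)).
Proof.
  intros Hj; apply rees_congruence; intros s z Hz; apply layer_pred;
    auto using layer_l, layer_r.
Qed.

(** Multiplying an element of [layer j] by anything gives [layer (S j)], so [TC2_of_products]
    applies; [layer 1] is everything. *)
Lemma reaches_layer (bl br : bool) j :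
  bl || br = true -> 1 <= j -> reaches mul bl br (rees (layer j)).
Proof.
  intros Hb Hj; induction Hj as [|j Hj IH].
  - apply reaches_total; intros a b; right; split; right; exact I.
  - assert (H1 := layer_congruence Hj).
    assert (H2 := layer_congruence (le_S _ _ Hj)).
    destruct (TC2_of_products H1 H2) as [Hl Hr].
    + intros a b c d [-> | [Ha Hb']] [-> | [Hc Hd]];
        [left; auto | right; auto using layer_l, layer_r ..].
    + apply reaches_step_total with (rees (layer j)); auto.
Qed.

End Powers.

(** * One-sided coordinates *)

Section OneSided.
Variables (T : Type) (mul : T -> T -> T).
Hypothesis assoc : forall x y z, mul x (mul y z) = mul (mul x y) z.
Variable K : T -> Prop.
Hypothesis K_l : forall s k, K k -> K (mul s k).
Hypothesis K_r : forall s k, K k -> K (mul k s).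
(** Stands for a label of the R-class on [K]; used with [rr], and with [ll] in the opposite
    semigroup. *)
Variable r : T -> T.
Hypothesis r_right : forall x s, K x -> r (mul x s) = r x.
Hypothesis r_left : forall s x y, K x -> K y -> r x = r y -> r (mul s x) = r (mul s y).

Local Infix "*" := mul.

Fixpoint same (j : nat) (a b : T) : Prop :=
  match j with
  | 0 => r a = r b
  | S j' => forall s, same j' (s * a) (s * b)
  end.

Lemma same_refl j a : same j a a.
Proof. revert a; induction j; simpl; auto. Qed.
Lemma same_sym j a b : same j a b -> same j b a.
Proof. revert a b; induction j; simpl; auto. Qed.
Lemma same_trans j a b c : same j a b -> same j b c -> same j a c.
Proof. revert a b c; induction j; simpl; intros; [congruence | eauto]. Qed.

Lemma same_S j a b : K a -> K b -> same j a b -> same (S j) a b.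
Proof.
  revert a b; induction j as [|j IH]; intros a b Ka Kb H; [simpl; auto | ].
  intros s; apply IH; auto; apply H.
Qed.

Lemma same_right j a b s t : K a -> K b -> same j (a * s) (b * t) <-> same j a b.
Proof.
  revert a b; induction j as [|j IH]; simpl; intros a b Ka Kb.
  - rewrite !r_right by auto; tauto.
  - split; intros H u; specialize (H u); [rewrite !assoc in H | rewrite !assoc];
      apply (IH (u * a) (u * b)); auto.
Qed.

(** After [m] left factors the prefix already lies in [K], and [r] sees only the prefix. *)
Lemma same_long m a b :
  1 <= m -> (forall z, inSm mul m z -> K z) -> same m a b.
Proof.
  intros Hm HK.
  assert (H : forall w, inSm mul m w -> r (w * a) = r (w * b)).
  { intros w Hw; rewrite !r_right; auto. }
  clear HK; revert a b H; induction Hm as [|m Hm IH]; intros a b H s.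
  - apply H; exact I.
  - apply IH; intros w Hw; rewrite !assoc; apply H.
    apply inSm_succ; eauto.
Qed.

Definition side (j : nat) (a b : T) : Prop := a = b \/ (K a /\ K b /\ same j a b).

Lemma side_same j a b : side j a b -> same j a b.
Proof. intros [-> | (_ & _ & H)]; auto using same_refl. Qed.

Lemma side_congruence j : congruence mul (side j).
Proof.
  assert (Ht : forall a b c, side j a b -> side j b c -> side j a c).
  { intros a b c [-> | (Ka & Kb & H)] [<- | (Kb' & Kc & H')];
      [left | right | right | right]; eauto using same_trans. }
  split; [left; auto | split; [ | split; [exact Ht | ]]].
  - intros a b [-> | (Ka & Kb & H)]; [left | right]; auto using same_sym.
  - intros a b c d Hab Hcd; apply Ht with (b * c).
    + destruct Hab as [-> | (Ka & Kb & H)]; [left; auto | right].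
      repeat split; auto; apply same_right; auto.
    + destruct Hcd as [-> | (Kc & Kd & H)]; [left; auto | right].
      repeat split; auto; apply (same_S j Kc Kd H).
Qed.

Lemma side_left j s a b : side (S j) a b -> side j (s * a) (s * b).
Proof. intros [-> | (Ka & Kb & H)]; [left; auto | right]; auto. Qed.

(** In a product, if the lower row of the left factor is constant, that constant is the multiplier
    taking [side (S j)] to [side j]. Otherwise this row lies in [K], right factors are invisible by
    [same_right], and the induction hypothesis for the left factor decides. *)
Lemma TC2_side_r j : TC2 mul (@total_rel T) (side (S j)) (side j).
Proof.
  intros a b c d H; induction H as [a c _ | a b H | p1 p2 p3 p4 q1 q2 q3 q4 H IH H' IH'];
    intros Hab; auto.
  - left; auto.
  - destruct (sq_rows (side_congruence (S j)) H) as [Hp Hp'].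
    destruct (sq_rows (side_congruence (S j)) H') as [Hq Hq'].
    destruct Hp' as [-> | (K3 & K4 & _)]; [apply side_left; auto | ].
    right; repeat split; auto; apply same_right; auto.
    apply side_same, IH.
    destruct Hp as [-> | (K1 & K2 & _)]; [left; auto | right; repeat split; auto].
    apply side_same in Hab; apply same_right in Hab; auto.
Qed.

Lemma sq_side_cases j be a b c d :
  sq mul (side j) be a b c d -> (a = c /\ b = d) \/ (K a /\ K b /\ K c /\ K d).
Proof.
  intros H; induction H as [a c [-> | (Ka & Kc & _)] | a b H
    | p1 p2 p3 p4 q1 q2 q3 q4 H IH H' IH']; auto.
  destruct IH as [[-> ->] | (K1 & K2 & K3 & K4)],
    IH' as [[-> ->] | (K1' & K2' & K3' & K4')]; auto 10.
Qed.

(** If the rows of the left factor coincide, the columns of the product are related and link the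
    lower row to the upper one. Otherwise the left factor lies in [K] and decides alone. *)
Lemma TC2_side_l j : TC2 mul (side (S j)) (@total_rel T) (side j).
Proof.
  destruct (side_congruence j) as (Sr & Ss & St & _).
  intros a b c d H; induction H as [a c _ | a b H | p1 p2 p3 p4 q1 q2 q3 q4 H IH H' IH'];
    intros Hab; auto.
  destruct (sq_cols (side_congruence (S j)) H') as [Hq Hq'].
  destruct (sq_side_cases H) as [[<- <-] | (K1 & K2 & K3 & K4)].
  - apply St with (p1 * q1); [apply Ss; apply side_left; auto | ].
    apply St with (p2 * q2); [auto | apply side_left; auto].
  - right; repeat split; auto; apply same_right; auto.
    apply side_same, IH; right; repeat split; auto.
    apply side_same in Hab; apply same_right in Hab; auto.
Qed.

End OneSided.

(** * Coordinates on a completely simple ideal *)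

Section CompletelySimple.
Variables (T : Type) (mul : T -> T -> T).
Hypothesis assoc : forall x y z, mul x (mul y z) = mul (mul x y) z.
Variable K : T -> Prop.
Hypothesis K_ideal : is_ideal mul K.
Hypothesis K_simple : simple_sub mul K.
Variable e : T.
Hypothesis e_primitive : primitive_idempotent mul K e.

Local Infix "*" := mul.

Definition Hcl (x : T) : Prop := K x /\ e * x = x /\ x * e = x.

Lemma K_l s k : K k -> K (s * k).
Proof. intros H; exact (proj1 (proj2 K_ideal s k H)). Qed.
Lemma K_r s k : K k -> K (k * s).
Proof. intros H; exact (proj2 (proj2 K_ideal s k H)). Qed.
Lemma K_e : K e.
Proof. apply e_primitive. Qed.
Lemma ee : e * e = e.
Proof. exact (proj1 (proj2 e_primitive)). Qed.
Lemma mulA x y z : (x * y) * z = x * (y * z).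
Proof. auto. Qed.

(** The products [a * (x * b)] form an ideal of [K], which is simple. *)
Lemma simple_factor x z : K x -> K z -> exists a b, K a /\ K b /\ z = a * (x * b).
Proof.
  intros Hx Hz.
  apply (@K_simple (fun z => exists a b, K a /\ K b /\ z = a * (x * b))); auto.
  - exists (x * (x * x)), x, x; auto.
  - intros j (a & b & Ha & Hb & ->); apply K_r; auto.
  - intros k j Hk (a & b & Ha & Hb & ->); split.
    + exists (k * a), b; rewrite !assoc; auto using K_l.
    + exists a, (b * k); rewrite !assoc; auto using K_l.
Qed.

Lemma Hcl_corner x : K x -> Hcl (e * (x * e)).
Proof.
  intros Hx; split; [apply K_l, K_r; auto | ].
  rewrite <- !assoc, ee; split; auto.
  rewrite !assoc, ee; auto.
Qed.

Lemma Hcl_corner_l x : e * x = x -> Hcl (x * e).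
Proof.
  intros Hx; split; [apply K_l, K_e | ].
  rewrite <- assoc, ee, assoc, Hx; auto.
Qed.

Lemma Hcl_corner_r x : x * e = x -> Hcl (e * x).
Proof.
  intros Hx; split; [apply K_r, K_e | ].
  rewrite <- assoc, Hx, assoc, ee; auto.
Qed.

Lemma Hcl_subgroup : subgroup mul Hcl e.
Proof.
  split; [repeat split; auto using K_e, ee | split; [ | split]].
  - intros x y (Kx & Hx & Hx') (Ky & Hy & Hy'); split; [apply K_l; auto | ].
    rewrite assoc, Hx, <- assoc, Hy'; auto.
  - intros x (_ & Hx); auto.
  - intros x (Kx & Hx & Hx').
    (* From e = axb, cutting [a] and [b] down to eKe gives a'xb' = e. Then x(b'a') and (b'a')x are
       idempotents below [e], so primitivity makes them equal to [e]. *)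
    destruct (simple_factor Kx K_e) as (a & b & Ka & Kb & E).
    assert (E1 : (e * (a * e)) * (x * (e * (b * e))) = e).
    { transitivity (e * ((a * (((e * x) * e) * b)) * e)); [rewrite !assoc; auto | ].
      rewrite Hx, Hx', <- E, !ee; auto. }
    set (a' := e * (a * e)) in *; set (b' := e * (b * e)) in *.
    destruct (Hcl_corner Ka) as (Ka' & Ha1 & Ha2); fold a' in Ka', Ha1, Ha2.
    destruct (Hcl_corner Kb) as (Kb' & Hb1 & Hb2); fold b' in Kb', Hb1, Hb2.
    destruct e_primitive as (_ & _ & Hp).
    exists (b' * a'); split; [ | split].
    + split; [apply K_l; auto | ]. rewrite assoc, Hb1, <- assoc, Ha2; auto.
    + apply Hp.
      * apply K_r; auto.
      * unfold idempotent.
        transitivity (x * (b' * ((a' * (x * b')) * a'))); [rewrite !assoc; auto | ].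
        rewrite E1, Ha1; auto.
      * rewrite assoc, Hx; auto.
      * rewrite <- !assoc, Ha2; auto.
    + apply Hp.
      * apply K_l; auto.
      * unfold idempotent.
        transitivity (b' * ((a' * (x * b')) * (a' * x))); [rewrite !assoc; auto | ].
        rewrite E1, (assoc e a' x), Ha1; rewrite !assoc; auto.
      * rewrite !assoc, Hb1; auto.
      * rewrite <- !assoc, Hx'; auto.
Qed.

Let HG := Hcl_subgroup.
Definition inv : T -> T := ginv mul Hcl e.

Ltac gin := repeat first
  [assumption | apply (G_mul HG) | apply (G_inv HG) | apply (G_one HG)].
Ltac group := unfold inv in *; repeat first
  [ rewrite mulA | rewrite (invMg assoc HG) by gin | rewrite (invgK assoc HG) by gin
  | rewrite (invg1 assoc HG) | rewrite (mulKg assoc HG) by gin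
  | rewrite (mulVKg assoc HG) by gin | rewrite (mulgV HG) by gin
  | rewrite (mulVg HG) by gin | rewrite (mul1g HG) by gin
  | rewrite (mulg1 HG) by gin ]; auto.

(* [x = rr x * cc x * ll x] are the coordinates of a Rees matrix representation
   whose sandwich matrix is normalised at the row and column of [e]. *)
Definition cc (x : T) : T := e * (x * e).
Definition rr (x : T) : T := x * inv (cc x).
Definition ll (x : T) : T := inv (cc x) * x.

Lemma cc_G x : K x -> Hcl (cc x).
Proof. apply Hcl_corner. Qed.
Lemma inv_G x : Hcl x -> Hcl (inv x).
Proof. apply (G_inv HG). Qed.
Lemma Ge x : Hcl x -> e * x = x.
Proof. intros (_ & H & _); auto. Qed.
Lemma Ge' x : Hcl x -> x * e = x.
Proof. intros (_ & _ & H); auto. Qed.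

Lemma cc_id x : Hcl x -> cc x = x.
Proof. intros (_ & H & H'); unfold cc; rewrite H', H; auto. Qed.

(** Write x = aeb, A = eae and B = ebe. Then [cc x] = AB, and x (AB)^-1 x = a B (AB)^-1 A b = a A^-1
    A b = aeb. *)
Lemma sandwich x : K x -> x * (inv (cc x) * x) = x.
Proof.
  intros Hx; destruct (simple_factor K_e Hx) as (a & b & Ka & Kb & E).
  assert (HA := Hcl_corner Ka); assert (HB := Hcl_corner Kb).
  set (A := e * (a * e)) in *; set (B := e * (b * e)) in *.
  assert (EC : cc x = A * B).
  { unfold cc, A, B; rewrite E.
    transitivity (e * (a * ((e * e) * (b * e)))); [rewrite ee | ]; rewrite !assoc; auto. }
  rewrite EC.
  assert (HI := inv_G (G_mul HG _ _ HA HB)).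
  transitivity (a * (e * (b * (e * inv (A * B))) * (e * (a * (e * b))))).
  { rewrite (Ge HI), E.
    transitivity (a * (e * b) * ((inv (A * B) * e) * (a * (e * b)))).
    - rewrite (Ge' HI); auto.
    - rewrite !assoc; auto. }
  transitivity (a * ((B * inv (A * B)) * (A * b))).
  { generalize (inv (A * B)); intros i; unfold A, B; rewrite !assoc; auto. }
  rewrite E; unfold inv; rewrite (invMg assoc HG) by auto.
  rewrite (mulVKg assoc HG) by gin.
  rewrite (assoc _ A b), (mulVg HG) by auto; auto.
Qed.

Lemma K_rr x : K x -> K (rr x).
Proof. intros; apply K_r; auto. Qed.
Lemma K_ll x : K x -> K (ll x).
Proof. intros; apply K_l; auto. Qed.
Lemma rr_e x : K x -> rr x * e = rr x.
Proof. intros; unfold rr; rewrite <- assoc, Ge'; auto using inv_G, cc_G. Qed.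
Lemma e_ll x : K x -> e * ll x = ll x.
Proof. intros; unfold ll; rewrite assoc, Ge; auto using inv_G, cc_G. Qed.
Lemma rr_mul x : K x -> rr x * x = x.
Proof. intros; unfold rr; rewrite <- assoc; apply sandwich; auto. Qed.
Lemma mul_ll x : K x -> x * ll x = x.
Proof. intros; apply sandwich; auto. Qed.

Lemma coords x : K x -> x = rr x * (cc x * ll x).
Proof.
  intros Hx.
  assert (HC := cc_G Hx).
  unfold rr, ll.
  rewrite (assoc (cc x)); unfold inv at 2; rewrite (mulgV HG _ HC).
  rewrite <- assoc, (assoc _ e x), Ge' by (apply inv_G; auto).
  rewrite sandwich; auto.
Qed.

Lemma coords_inj x y : K x -> K y -> rr x = rr y -> cc x = cc y -> ll x = ll y -> x = y.
Proof. intros Hx Hy Hr Hc Hl; rewrite (coords Hx), (coords Hy); congruence. Qed.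

Lemma rr_mul_r x s : K x -> rr (x * s) = rr x.
Proof.
  intros Hx.
  assert (HC : Hcl (cc (x * s))) by (apply cc_G, K_r; auto).
  unfold rr at 1.
  rewrite <- (rr_mul Hx) at 1; rewrite <- (rr_e Hx), <- (Ge (inv_G HC)).
  transitivity (rr x * (cc (x * s) * inv (cc (x * s)))).
  - unfold cc at 2; rewrite !assoc; auto.
  - unfold inv; rewrite (mulgV HG _ HC); auto.
Qed.

Lemma ll_mul_l x s : K x -> ll (s * x) = ll x.
Proof.
  intros Hx.
  assert (HC : Hcl (cc (s * x))) by (apply cc_G, K_l; auto).
  unfold ll at 1.
  rewrite <- (mul_ll Hx) at 2; rewrite <- (e_ll Hx), <- (Ge' (inv_G HC)).
  transitivity (inv (cc (s * x)) * cc (s * x) * ll x).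
  - unfold cc at 3; rewrite !assoc; auto.
  - unfold inv; rewrite (mulVg HG _ HC); auto.
Qed.

Lemma rr_mul_l s x y : K x -> K y -> rr x = rr y -> rr (s * x) = rr (s * y).
Proof.
  assert (H : forall z, K z -> rr (s * z) = rr (s * rr z)).
  { intros z Hz; rewrite <- (rr_mul Hz) at 1; rewrite assoc, rr_mul_r; auto using K_l, K_rr. }
  intros Hx Hy E; rewrite H, E, <- H; auto.
Qed.

Lemma ll_mul_r s x y : K x -> K y -> ll x = ll y -> ll (x * s) = ll (y * s).
Proof.
  assert (H : forall z, K z -> ll (z * s) = ll (ll z * s)).
  { intros z Hz; rewrite <- (mul_ll Hz) at 1; rewrite mulA, ll_mul_l; auto using K_r, K_ll. }
  intros Hx Hy E; rewrite H, E, <- H; auto.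
Qed.

(** The multiplier involves [x] only through [rr x]: on an R-class, left multiplication by [s] acts
    on [cc] as one fixed group element. *)
Lemma cc_mul_l s x : K x -> cc (s * x) = (e * (s * rr x)) * cc x.
Proof.
  intros Hx; unfold cc; rewrite <- (rr_mul Hx) at 1; rewrite <- (rr_e Hx) at 1.
  rewrite !assoc; auto.
Qed.

Lemma cc_mul_r x s : K x -> cc (x * s) = cc x * (ll x * (s * e)).
Proof.
  intros Hx; unfold cc; rewrite <- (mul_ll Hx) at 1; rewrite <- (e_ll Hx) at 1.
  rewrite !assoc; auto.
Qed.

Lemma G_l_factor s x : K x -> Hcl (e * (s * rr x)).
Proof. intros Hx; apply Hcl_corner_r; rewrite <- assoc, rr_e; auto. Qed.

Lemma G_r_factor x s : K x -> Hcl (ll x * (s * e)).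
Proof. intros Hx; rewrite assoc; apply Hcl_corner_l; rewrite assoc, e_ll; auto. Qed.

(** For [N = Hcl] this is Green's relation H on [K], extended by equality; smaller [N] split the
    H-classes into cosets of [N]. *)
Definition gam (N : T -> Prop) (a b : T) : Prop :=
  a = b \/ (K a /\ K b /\ rr a = rr b /\ ll a = ll b /\ N (inv (cc a) * cc b)).

Notation normal := (normal_subgroup mul Hcl e).

Lemma cc_mul_l_quot s x y : K x -> K y -> rr x = rr y ->
  inv (cc (s * x)) * cc (s * y) = inv (cc x) * cc y.
Proof.
  intros Hx Hy E; rewrite !cc_mul_l, E by auto.
  assert (h1 := cc_G Hx); assert (h2 := cc_G Hy); assert (h3 := G_l_factor s Hy).
  set (u := e * (s * rr y)) in *; group.
Qed.

Lemma cc_mul_r_quot s x y : K x -> K y -> ll x = ll y ->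
  inv (cc (x * s)) * cc (y * s) =
  inv (ll x * (s * e)) * ((inv (cc x) * cc y) * (ll x * (s * e))).
Proof.
  intros Hx Hy E; rewrite !cc_mul_r, <- E by auto.
  assert (h1 := cc_G Hx); assert (h2 := cc_G Hy); assert (h3 := G_r_factor s Hx).
  set (u := ll x * (s * e)) in *; group.
Qed.

Lemma gam_congruence N : normal N -> congruence mul (gam N).
Proof.
  intros (NG & N1 & NM & NV & NJ).
  assert (Ht : forall a b c, gam N a b -> gam N b c -> gam N a c).
  { intros a b c [-> | (Ka & Kb & Hr & Hl & Hn)] [<- | (Kb' & Kc & Hr' & Hl' & Hn')];
      [left; auto | right; repeat split; auto | right; repeat split; auto | right].
    repeat split; auto; try congruence.
    replace (inv (cc a) * cc c) with ((inv (cc a) * cc b) * (inv (cc b) * cc c)); auto.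
    assert (h1 := cc_G Ka); assert (h2 := cc_G Kb); assert (h3 := cc_G Kc); group. }
  split; [left; auto | split; [ | split; [exact Ht | ]]].
  - intros a b [-> | (Ka & Kb & Hr & Hl & Hn)]; [left; auto | right].
    repeat split; auto.
    replace (inv (cc b) * cc a) with (inv (inv (cc a) * cc b)); [apply NV; auto | ].
    assert (h1 := cc_G Ka); assert (h2 := cc_G Kb); group.
  - intros a b c d Hab Hcd; apply Ht with (b * c).
    + destruct Hab as [-> | (Ka & Kb & Hr & Hl & Hn)]; [left; auto | right].
      repeat split; auto using K_r, ll_mul_r.
      * rewrite !rr_mul_r; auto.
      * rewrite cc_mul_r_quot by auto; apply NJ; auto using G_r_factor.
    + destruct Hcd as [-> | (Ka & Kb & Hr & Hl & Hn)]; [left; auto | right].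
      repeat split; auto using K_l, rr_mul_l.
      * rewrite !ll_mul_l; auto.
      * rewrite cc_mul_l_quot; auto.
Qed.

Lemma gam_eq N a b : (forall z, N z -> z = e) -> gam N a b -> a = b.
Proof.
  intros HN [H | (Ka & Kb & Hr & Hl & Hn)]; auto.
  apply coords_inj; auto.
  assert (h1 := cc_G Ka); assert (h2 := cc_G Kb).
  assert (E : cc a * (inv (cc a) * cc b) = cc a * e) by (rewrite (HN _ Hn); auto).
  rewrite Ge' in E by auto; rewrite <- E; group.
Qed.

(** * Centrality of the congruences of the structure group *)

Section Central.
Variables (al : rel T) (N M : T -> Prop).
Hypothesis al_cong : congruence mul al.
Hypothesis N_normal : normal N.
Hypothesis M_normal : normal M.
(** Supplied below by [N, G] <= M when [al] is total, and by [N, N] <= M when [al] is [gam N]. *)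
Hypothesis central : forall c c' n, Hcl c -> Hcl c' -> al c c' -> N n ->
  M (inv (inv c * (n * c)) * (inv c' * (n * c'))).

Definition shift (a b c d : T) : Prop :=
  K a /\ K b /\ K c /\ K d /\ rr a = rr b /\ ll a = ll b /\ rr c = rr d /\ ll c = ll d /\
  N (inv (cc a) * cc b) /\ N (inv (cc c) * cc d) /\
  M (inv (inv (cc a) * cc b) * (inv (cc c) * cc d)).

Lemma shift_trans a b f c d h : shift a b c d -> shift b f d h -> shift a f c h.
Proof.
  destruct N_normal as (NG & N1 & NM & NV & NJ), M_normal as (MG & M1 & MM & MV & MJ).
  intros (Ka & Kb & Kc & Kd & H1 & H2 & H3 & H4 & n1 & n2 & m)
    (_ & Kf & _ & Kh & H5 & H6 & H7 & H8 & n3 & n4 & m').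
  assert (h1 := cc_G Ka); assert (h2 := cc_G Kb); assert (h3 := cc_G Kc).
  assert (h4 := cc_G Kd); assert (h5 := cc_G Kf); assert (h6 := cc_G Kh).
  repeat split; auto; try congruence.
  - replace (inv (cc a) * cc f) with ((inv (cc a) * cc b) * (inv (cc b) * cc f));
      [auto | group].
  - replace (inv (cc c) * cc h) with ((inv (cc c) * cc d) * (inv (cc d) * cc h));
      [auto | group].
  - set (p := inv (cc b) * cc f) in *.
    assert (hp : Hcl p) by auto.
    replace (inv (inv (cc a) * cc f) * (inv (cc c) * cc h)) with
      ((inv p * ((inv (inv (cc a) * cc b) * (inv (cc c) * cc d)) * p)) *
       (inv p * (inv (cc d) * cc h))); [auto | unfold p in *; group].
Qed.

Lemma al_inv a c : Hcl a -> Hcl c -> al a c -> al (inv a) (inv c).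
Proof.
  destruct al_cong as (Ar & As & At & Am); intros Ha Hc H.
  replace (inv a) with (inv a * (c * inv c)) by group.
  replace (inv c) with (inv a * (a * inv c)) at 2 by group.
  apply Am; auto.
Qed.

(** A product is changed one factor at a time. Left multiplication keeps the row quotients; right
    multiplication conjugates them by group elements that are [al]-related for the two rows, which
    [central] controls. *)
Lemma sq_shift a b c d : sq mul al (gam N) a b c d -> (a = b /\ c = d) \/ shift a b c d.
Proof.
  destruct al_cong as (Ar & As & At & Am).
  assert (Nn := N_normal); destruct Nn as (NG & N1 & NM & NV & NJ).
  intros H; induction H as
    [a c Hac | a b [-> | (Ka & Kb & Hr & Hl & Hn)] |
     a b c d a' b' c' d' H1 IH1 H2 IH2]; auto.
  - right; repeat split; auto.
    assert (h1 := cc_G Ka); assert (h2 := cc_G Kb).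
    destruct M_normal as (_ & M1 & _); group.
  - assert (Hl : forall s s', shift a b c d -> al s s' ->
      shift (a * s) (b * s) (c * s') (d * s')).
    { intros s s' (Ka & Kb & Kc & Kd & E1 & E2 & E3 & E4 & n1 & n2 & m) Hs.
      destruct (sq_cols al_cong H1) as [Hac _].
      assert (h1 := G_r_factor s Ka); assert (h2 := G_r_factor s' Kc).
      assert (h3 := cc_G Ka); assert (h4 := cc_G Kc).
      unfold shift; rewrite !rr_mul_r by auto.
      rewrite !cc_mul_r_quot by auto.
      repeat split; auto using K_r, ll_mul_r.
      assert (Hll : al (ll a * (s * e)) (ll c * (s' * e))).
      { apply Am; [ | apply Am; auto].
        unfold ll; apply Am; auto.
        apply al_inv; auto; unfold cc; auto. }
      set (u := ll a * (s * e)) in *; set (v := ll c * (s' * e)) in *.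
      set (n := inv (cc a) * cc b) in *; set (n' := inv (cc c) * cc d) in *.
      destruct M_normal as (MG & M1 & MM & MV & MJ).
      assert (hn : Hcl n) by auto; assert (hn' : Hcl n') by auto.
      replace (inv (inv u * (n * u)) * (inv v * (n' * v))) with
        ((inv (inv u * (n * u)) * (inv v * (n * v))) *
         (inv v * ((inv n * n') * v))) by group.
      apply MM; auto. }
    assert (Hr : forall s s', shift a' b' c' d' ->
      shift (s * a') (s * b') (s' * c') (s' * d')).
    { intros s s' (Ka & Kb & Kc & Kd & E1 & E2 & E3 & E4 & n1 & n2 & m).
      unfold shift; rewrite !ll_mul_l by auto.
      rewrite !cc_mul_l_quot by auto.
      repeat split; auto using K_l, rr_mul_l. }
    destruct (sq_cols al_cong H2) as [Hac' _].
    destruct IH1 as [[-> ->] | S1], IH2 as [[-> ->] | S2]; auto.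
    right; apply shift_trans with (b * a') (d * c'); auto.
Qed.

Lemma TC2_gam_r : TC2 mul al (gam N) (gam M).
Proof.
  intros a b c d Hs Hab.
  destruct (sq_shift Hs) as [[_ ->] |
    (Ka & Kb & Kc & Kd & E1 & E2 & E3 & E4 & n1 & n2 & m)]; [left; auto | right].
  repeat split; auto.
  destruct M_normal as (MG & M1 & MM & MV & MJ).
  assert (h1 := cc_G Ka); assert (h2 := cc_G Kb).
  assert (h3 := cc_G Kc); assert (h4 := cc_G Kd).
  assert (Hm : M (inv (cc a) * cc b)).
  { destruct Hab as [-> | (_ & _ & _ & _ & Hm)]; auto.
    replace (inv (cc b) * cc b) with e; auto; group. }
  replace (inv (cc c) * cc d) with
    ((inv (cc a) * cc b) * (inv (inv (cc a) * cc b) * (inv (cc c) * cc d))); auto.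
  group.
Qed.

(** Transposed, [sq_shift] compares the column quotients modulo [M]. The lower row quotient is a
    conjugate of the upper one times this discrepancy. *)
Lemma TC2_gam_l : TC2 mul (gam N) al (gam M).
Proof.
  intros a b c d Hs Hab; apply sq_transpose in Hs.
  destruct (sq_shift Hs) as [[<- <-] |
    (Ka & Kc & Kb & Kd & E1 & E2 & E3 & E4 & n1 & n2 & m)]; auto.
  destruct M_normal as (MG & M1 & MM & MV & MJ).
  assert (h1 := cc_G Ka); assert (h2 := cc_G Kb).
  assert (h3 := cc_G Kc); assert (h4 := cc_G Kd).
  assert (Hm : rr a = rr b /\ ll a = ll b /\ M (inv (cc a) * cc b)).
  { destruct Hab as [-> | (_ & _ & Hr & Hl & Hm)]; auto.
    repeat split; auto; replace (inv (cc b) * cc b) with e; auto; group. }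
  destruct Hm as (Hr & Hl & Hm).
  right; repeat split; auto; try congruence.
  set (n := inv (cc a) * cc c) in *.
  assert (hn : Hcl n) by (unfold n; unfold inv; gin).
  replace (inv (cc c) * cc d) with
    ((inv n * ((inv (cc a) * cc b) * n)) * (inv n * (inv (cc b) * cc d))); auto.
  unfold n in *; group.
Qed.

End Central.

(** As n^c = n [n, c], the element is [n, c]^-1 [n, c']. *)
Lemma central_total (N M : T -> Prop) :
  normal N -> normal M ->
  (forall n g, N n -> Hcl g -> M (cm mul Hcl e n g)) ->
  forall c c' n, Hcl c -> Hcl c' -> total_rel c c' -> N n ->
    M (inv (inv c * (n * c)) * (inv c' * (n * c'))).
Proof.
  intros (NG & _) (MG & _ & MM & MV & _) H c c' n Hc Hc' _ Hn.
  assert (h := NG _ Hn).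
  replace (inv (inv c * (n * c)) * (inv c' * (n * c')))
    with (inv (cm mul Hcl e n c) * cm mul Hcl e n c'); [apply MM; auto; apply MV; auto | ].
  unfold cm; fold inv; group.
Qed.

(** If c and c' differ, c^-1 c' lies in [N], and the element is the commutator of n^c with c^-1
    c'. *)
Lemma central_gam (N M : T -> Prop) :
  normal N -> normal M ->
  (forall n g, N n -> N g -> M (cm mul Hcl e n g)) ->
  forall c c' n, Hcl c -> Hcl c' -> gam N c c' -> N n ->
    M (inv (inv c * (n * c)) * (inv c' * (n * c'))).
Proof.
  intros (NG & N1 & NM & NV & NJ) (MG & M1 & _) H c c' n Hc Hc' Hcc Hn.
  assert (h := NG _ Hn).
  destruct Hcc as [<- | (_ & _ & _ & _ & Hk)].
  - replace (inv (inv c * (n * c)) * (inv c * (n * c))) with e; auto; group.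
  - rewrite !cc_id in Hk by auto.
    replace (inv (inv c * (n * c)) * (inv c' * (n * c')))
      with (cm mul Hcl e (inv c * (n * c)) (inv c * c')); [apply H; auto; apply NJ; auto | ].
    unfold cm; fold inv; group.
Qed.

(** * Descent of the three series through these congruences *)

Definition both_sides (j : nat) (a b : T) : Prop :=
  side mul K rr j a b /\ side (fun x y => mul y x) K ll j a b.

Lemma both_sides_congruence j : congruence mul (both_sides j).
Proof.
  apply congruence_and.
  - apply side_congruence; auto using K_l, K_r, rr_mul_r, rr_mul_l.
  - apply congruence_opposite, side_congruence;
      auto using K_l, K_r, ll_mul_l, ll_mul_r.
Qed.

Lemma TC2_both_sides j :
  TC2 mul (@total_rel T) (both_sides (S j)) (both_sides j) /\
  TC2 mul (both_sides (S j)) (@total_rel T) (both_sides j).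
Proof.
  assert (Hl : rel_le (both_sides (S j)) (side mul K rr (S j))) by (intros a b []; auto).
  assert (Hr : rel_le (both_sides (S j)) (side (fun x y => mul y x) K ll (S j)))
    by (intros a b []; auto).
  assert (Ht : rel_le (@total_rel T) (@total_rel T)) by (intros a b; auto).
  split; apply TC2_and.
  - apply (TC2_mono Ht Hl); apply TC2_side_r;
      auto using K_l, K_r, rr_mul_r, rr_mul_l.
  - apply (TC2_mono Ht Hr); apply TC2_opposite, TC2_side_r;
      auto using K_l, K_r, ll_mul_l, ll_mul_r.
  - apply (TC2_mono Hl Ht); apply TC2_side_l;
      auto using K_l, K_r, rr_mul_r, rr_mul_l.
  - apply (TC2_mono Hr Ht); apply TC2_opposite, TC2_side_l;
      auto using K_l, K_r, ll_mul_l, ll_mul_r.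
Qed.

Lemma inSm_opposite m z : inSm (fun x y => y * x) m z -> inSm mul m z.
Proof.
  revert z; induction m as [|[|m] IH]; intros z; [tauto | tauto | ].
  intros (x & y & Hx & ->); apply inSm_cons; [auto | lia | apply IH; auto].
Qed.

(** [layer m] is [K], whose elements agree in both labels after [m] factors, so its Rees congruence
    is below [both_sides m]; at [both_sides 0] the labels themselves agree. *)
Lemma reaches_gam (bl br : bool) :
  bl || br = true -> nilpotent_extension mul K -> reaches mul bl br (gam Hcl).
Proof.
  intros Hb (m & Hm & HS).
  assert (H : reaches mul bl br (both_sides m)).
  { apply reaches_le with (2 := reaches_layer mul assoc K K_l K_r bl br Hb Hm).
    intros a b [-> | [Ha Hb']]; [split; left; auto | ].
    assert (Ka : K a) by (destruct Ha; auto).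
    assert (Kb : K b) by (destruct Hb'; auto).
    split; right; repeat split; auto; apply same_long with (K := K); auto using rr_mul_r, ll_mul_l.
    intros z Hz; apply HS, inSm_opposite; auto. }
  clear Hm HS; induction m as [|m IH].
  - apply reaches_le with (2 := H).
    intros a b [[-> | (Ka & Kb & Hr)] [E | (_ & _ & Hl)]]; [left; auto .. | subst; left; auto | ].
    right; repeat split; auto; try (apply K_l; auto using cc_G; fail).
    all: apply (G_mul HG); auto using inv_G, cc_G.
  - apply IH; destruct (TC2_both_sides m).
    apply reaches_step_total with (both_sides (S m)); auto using both_sides_congruence.
Qed.

Lemma derived_reaches k :
  nilpotent_extension mul K -> reaches mul true true (gam (derived_series mul Hcl e k)).
Proof.
  intros Hn; induction k as [|k IH]; simpl; [apply reaches_gam; auto | ].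
  assert (N1 := derived_normal assoc HG k).
  assert (N2 := derived_normal assoc HG (S k)); simpl in N2.
  apply reaches_step with (gam (derived_series mul Hcl e k)); auto using gam_congruence.
  apply TC2_gam_r; auto using gam_congruence.
  apply central_gam; auto.
  intros; apply comm_sub_cm; auto; apply N1.
Qed.

Lemma lower_central_reaches (bl br : bool) k :
  bl || br = true -> nilpotent_extension mul K ->
  reaches mul bl br (gam (lower_central mul Hcl e k)).
Proof.
  intros Hb Hn; induction k as [|k IH]; [apply reaches_gam; auto | ].
  assert (N1 := lower_central_normal assoc HG k).
  assert (N2 := lower_central_normal assoc HG (S k)).
  assert (HC := central_total N1 N2 (fun n g => lower_central_cm assoc HG k n g)).
  apply reaches_step_total with (gam (lower_central mul Hcl e k)); auto using gam_congruence.
  - apply TC2_gam_r; auto using total_congruence.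
  - apply TC2_gam_l; auto using total_congruence.
Qed.

Lemma reaches_trivial (bl br : bool) (N : T -> Prop) :
  (forall z, N z -> z = e) -> reaches mul bl br (gam N) ->
  exists d, is_zero (series mul bl br d).
Proof.
  intros HN H; apply reaches_zero; apply reaches_le with (2 := H).
  intros a b; apply gam_eq; auto.
Qed.

(** * Supernilpotence of nilpotent extensions *)

Lemma cc_word_cube m n r f :
  1 <= m -> (forall z, inSm mul m z -> K z) ->
  word mul n r f -> cube_map mul Hcl e (S m) n (fun x => cc (f x)).
Proof.
  intros Hm HS; revert f; induction r as [|r IH]; intros f Hf; [inversion Hf | ].
  destruct (le_lt_dec (S r) (S m)) as [Hr | Hr].
  - destruct (word_depends Hf) as (B & HB & Hd).
    apply cube_map_depends with (B := B); auto; [ | lia | ].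
    + intros x y Hxy; rewrite (Hd x y Hxy); auto.
    + (* a short word need not lie in K, but its e-corner does *)
      intros x; unfold cc; rewrite assoc; apply Hcl_corner_l; rewrite assoc, ee; auto.
  - inversion Hf as [ | r' g i a b Hg Hi E E']; subst; [lia | ].
    assert (Hs : exists u v, word mul n m v /\ forall x, g x = u x * v x).
    { replace r with ((r - m) + m) in Hg by lia.
      apply word_split in Hg; auto; [ | lia].
      destruct Hg as (u & v & _ & Hv & Eg); eauto. }
    destruct Hs as (u & v & Hv & Eg).
    assert (Kv : forall x, K (v x)) by (intros x; apply HS; apply (word_inSm x Hv)).
    set (h := fun x : nat -> bool => if x i then b else a).
    (* The new factor of [cc] involves [g x] only through [ll], which is determined by the last [m]
       letters; with the new letter it depends on at most [m + 1] coordinates. *)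
    assert (E : (fun x => cc (g x * (if x i then b else a))) =
      (fun x => cc (g x) * (ll (v x) * (h x * e)))).
    { apply functional_extensionality; intros x; fold (h x).
      assert (Kg : K (g x)) by (rewrite Eg; apply K_l; auto).
      rewrite cc_mul_r by auto; rewrite (Eg x) at 2; rewrite ll_mul_l; auto. }
    rewrite E; apply cube_map_mul; auto.
    destruct (word_depends Hv) as (B & HB & Hd).
    apply cube_map_depends with (B := i :: B); auto.
    + intros x y Hxy; unfold h; rewrite (Hxy i), (Hd x y); simpl; auto.
      intros j Hj; apply Hxy; simpl; auto.
    + simpl; lia.
    + intros x; apply G_r_factor; auto.
Qed.

Lemma rr_ll_word m n r f :
  1 <= m -> (forall z, inSm mul m z -> K z) -> m < r -> word mul n r f ->
  exists B B', length B <= m /\ length B' <= m /\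
    depends B (fun x => rr (f x)) /\ depends B' (fun x => ll (f x)).
Proof.
  intros Hm HS Hr Hf.
  assert (Hf' := Hf); replace r with (m + (r - m)) in Hf by lia.
  replace r with ((r - m) + m) in Hf' by lia.
  apply word_split in Hf; auto; [ | lia]; destruct Hf as (u & v & Hu & _ & E).
  apply word_split in Hf'; auto; [ | lia]; destruct Hf' as (u' & v' & _ & Hv' & E').
  destruct (word_depends Hu) as (B & HB & Hd), (word_depends Hv') as (B' & HB' & Hd').
  exists B, B'; repeat split; auto.
  - intros x y Hxy; rewrite !E, !rr_mul_r, (Hd x y Hxy); auto;
      apply HS; apply (word_inSm _ Hu).
  - intros x y Hxy; rewrite !E', !ll_mul_l, (Hd' x y Hxy); auto;
      apply HS; apply (word_inSm _ Hv').
Qed.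

Lemma supernilpotent_of_extension :
  nilpotent_extension mul K -> group_nilpotent mul Hcl e -> sg_supernilpotent mul.
Proof.
  intros (m & Hm & HS) (c & Hc).
  (* With [b = S m] this makes [d + 1 > b * 2 ^ c], as [cube_map_TC] requires. *)
  set (d := (S m * 2 ^ c)%nat); exists d.
  assert (Hd : S m <= d).
  { assert (2 ^ c <> 0) by (apply Nat.pow_nonzero; lia); unfold d; nia. }
  apply is_zero_le with mul; [apply ncomm_congruence | ].
  intros a b Hab; apply Hab; [apply eq_congruence | ].
  intros f Hf Hp; destruct (inM_word assoc Hf) as [r Hr].
  destruct (le_lt_dec r m) as [Hrm | Hrm].
  (* A short word need not lie in [K], but it misses one of the [d + 1] coordinates. *)
  { destruct (word_depends Hr) as (B & HB & HBd).
    apply depends_TC with B; auto; lia. }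
  destruct (rr_ll_word Hm HS Hrm Hr) as (B & B' & HB & HB' & HBd & HBd').
  assert (Kf : forall x, K (f x)).
  { intros x; replace r with (m + (r - m)) in Hr by lia.
    apply word_split in Hr; auto; [ | lia]; destruct Hr as (u & v & Hu & _ & E).
    rewrite E; apply K_r, HS; apply (word_inSm _ Hu). }
  apply coords_inj; auto.
  - apply (depends_TC (F := fun x => rr (f x)) HBd); [lia | ].
    intros x Hx; rewrite (Hp x Hx); auto.
  - apply cube_map_TC with (G := Hcl) (e := e) (mul := mul) (b := S m) (c := c)
      (F := fun x => cc (f x)); auto.
    + unfold d; lia.
    + apply cc_word_cube with r; auto.
    + intros x Hx; rewrite (Hp x Hx); auto.
  - apply (depends_TC (F := fun x => ll (f x)) HBd'); [lia | ].
    intros x Hx; rewrite (Hp x Hx); auto.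
Qed.

(** * Solvable and nilpotent semigroups are nilpotent extensions *)

(* Some factor [f] of [K] can be inserted into [w] modulo [th], at a place that does
   not depend on [x], without [x] noticing. *)
Definition absorbs (th : rel T) (w : T) : Prop :=
  exists a b, w = a * b /\
    forall x, K x -> exists f, K f /\ x * (a * f) = x * a /\ th w (a * (f * b)).

Lemma absorbs_total s t : absorbs (@total_rel T) (s * t).
Proof.
  exists s, t; split; auto; intros x Hx; exists (ll (x * s)).
  repeat split; auto using K_ll, K_r.
  rewrite assoc, mul_ll; auto using K_r.
Qed.

(** The rows start with w1 after and before inserting f1, the columns end with w2 before and after
    inserting f2. As f2 is chosen so that f1 b1 does not notice it, the upper row is constant, and
    the term condition inserts f2 in the lower one. *)
Lemma absorbs_derived th w1 w2 :
  congruence mul th -> absorbs th w1 -> absorbs th w2 -> absorbs (comm2 mul th th) (w1 * w2).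
Proof.
  intros (Tr & Ts & Tt & Tm) (a1 & b1 & E1 & H1) (a2 & b2 & E2 & H2).
  exists (w1 * a2), b2; split; [rewrite E2; auto | intros x Hx].
  destruct (H1 x Hx) as (f1 & Kf1 & P1 & Q1).
  destruct (H2 (f1 * b1)) as (f2 & Kf2 & P2 & Q2); [apply K_r; auto | ].
  exists f2; split; [auto | split].
  - transitivity ((x * (a1 * f1)) * (b1 * (a2 * f2))); [rewrite P1, E1, !assoc; auto | ].
    transitivity ((x * a1) * ((f1 * b1) * (a2 * f2))); [rewrite !assoc; auto | ].
    rewrite P2; transitivity ((x * (a1 * f1)) * (b1 * a2)); [rewrite !assoc; auto | ].
    rewrite P1, E1, !assoc; auto.
  - rewrite <- assoc.
    refine (comm2_TC2 (sq_mul (sq_fst _ _ (Ts _ _ Q1)) (sq_snd _ _ Q2)) _).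
    replace (a1 * (f1 * b1) * (a2 * (f2 * b2))) with (a1 * (f1 * b1) * w2).
    + apply (proj1 (ncomm_congruence mul _ _)).
    + transitivity (a1 * (((f1 * b1) * (a2 * f2)) * b2)); [ | rewrite !assoc; auto].
      rewrite P2, E2, !assoc; auto.
Qed.

(** The insertion goes after all of [w]: [ll (f1 * b)] is a right identity of [f1 * b], hence
    unnoticed in the row where [f1] has been inserted. *)
Lemma absorbs_right th w s :
  congruence mul th -> absorbs th w -> absorbs (comm2 mul th (@total_rel T)) (w * s).
Proof.
  intros (Tr & Ts & Tt & Tm) (a & b & E & H).
  exists w, s; split; auto; intros x Hx.
  destruct (H x Hx) as (f1 & Kf1 & P1 & Q1).
  assert (P2 := mul_ll (K_r b Kf1)); set (f2 := ll (f1 * b)) in *.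
  exists f2; split; [apply K_ll, K_r; auto | split].
  - transitivity ((x * (a * f1)) * (b * f2)); [rewrite P1, E, !assoc; auto | ].
    transitivity ((x * a) * ((f1 * b) * f2)); [rewrite !assoc; auto | ].
    rewrite P2; transitivity ((x * (a * f1)) * b); [rewrite !assoc; auto | ].
    rewrite P1, E, !assoc; auto.
  - refine (comm2_TC2 (sq_mul (sq_fst _ _ (Ts _ _ Q1)) (sq_snd s (f2 * s) I)) _).
    replace (a * (f1 * b) * (f2 * s)) with (a * (f1 * b) * s).
    + apply (proj1 (ncomm_congruence mul _ _)).
    + rewrite <- P2 at 1; rewrite !assoc; auto.
Qed.

(** Here [x] itself enters the matrix: the upper row starts with [x * s], totally related to [s],
    and [f] is chosen so that [x * s] does not notice it. *)
Lemma absorbs_left th w s :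
  absorbs th w -> absorbs (comm2 mul (@total_rel T) th) (s * w).
Proof.
  intros (a & b & E & H).
  exists (s * a), b; split; [rewrite E; auto | intros x Hx].
  destruct (H (x * s)) as (f & Kf & P & Q); [apply K_r; auto | ].
  exists f; split; [auto | split].
  - transitivity ((x * s) * (a * f)); [ | rewrite P]; rewrite !assoc; auto.
  - rewrite <- assoc.
    refine (comm2_TC2 (sq_mul (sq_fst (x * s) s I) (sq_snd _ _ Q)) _).
    replace (x * s * (a * (f * b))) with (x * s * w).
    + apply (proj1 (ncomm_congruence mul _ _)).
    + transitivity (((x * s) * (a * f)) * b); [rewrite P, E | ]; rewrite !assoc; auto.
Qed.

Lemma absorbs_zero th w : is_zero th -> absorbs th w -> K w.
Proof.
  intros Hz (a & b & E & H).
  destruct (H e K_e) as (f & Kf & _ & Q); apply Hz in Q.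
  rewrite Q; apply K_l, K_r; auto.
Qed.

Lemma absorbs_total_pow m w : 2 <= m -> inSm mul m w -> absorbs (@total_rel T) w.
Proof.
  destruct m as [|[|m]]; [lia | lia | ].
  intros _ (x & y & _ & ->); apply absorbs_total.
Qed.

Lemma solvable_extension : sg_solvable mul -> nilpotent_extension mul K.
Proof.
  (* Two factors suffice for the total congruence, and every derived step doubles the length. *)
  intros [d Hd]; exists (2 ^ S d).
  assert (P : forall k, 1 <= 2 ^ k)
    by (intros k; apply Nat.neq_0_lt_0, Nat.pow_nonzero; lia).
  split; auto; intros z Hz; apply (absorbs_zero Hd).
  clear Hd; revert z Hz; induction d as [|d IH]; intros z Hz.
  - apply (@absorbs_total_pow 2); auto.
  - replace (2 ^ S (S d)) with (2 ^ S d + 2 ^ S d) in Hz by (simpl; lia).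
    apply inSm_split in Hz; auto; destruct Hz as (x & y & Hx & Hy & ->).
    apply (@absorbs_derived (derived_cong mul d));
      [rewrite <- series_derived; apply series_congruence | apply IH; auto ..].
Qed.

Lemma left_nilpotent_extension : sg_left_nilpotent mul -> nilpotent_extension mul K.
Proof.
  intros [d Hd]; exists (2 + d); split; [lia | ].
  intros z Hz; apply (absorbs_zero Hd).
  clear Hd; revert z Hz; induction d as [|d IH]; intros z Hz.
  - apply (@absorbs_total_pow 2); auto.
  - replace (2 + S d) with (1 + (2 + d)) in Hz by lia.
    apply inSm_split in Hz; auto; [ | lia]; destruct Hz as (x & y & _ & Hy & ->).
    apply (@absorbs_left (lcs mul d)); auto.
Qed.

Lemma right_nilpotent_extension : sg_right_nilpotent mul -> nilpotent_extension mul K.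
Proof.
  intros [d Hd]; exists (2 + d); split; [lia | ].
  intros z Hz; apply (absorbs_zero Hd).
  clear Hd; revert z Hz; induction d as [|d IH]; intros z Hz.
  - apply (@absorbs_total_pow 2); auto.
  - replace (2 + S d) with (S (2 + d)) in Hz by lia.
    apply inSm_succ in Hz; [ | lia]; destruct Hz as (x & y & Hx & ->).
    apply (@absorbs_right (rcs mul d)); auto; rewrite <- series_rcs; apply series_congruence.
Qed.

(** The 0-value of each letter is [e] times the product of all letters up to it. So the last
    coordinate 0 restarts the product, and what came before is collected in [p]. *)
Lemma power_inM n k y : 1 <= k -> k <= n -> inSm mul k y ->
  exists f, inM mul n (fun _ => @total_rel T) f /\
    (forall x, (forall j, j < k -> x j = true) -> f x = y) /\
    (forall x j, j < k -> x j = false -> exists p, f x = p * (e * y)) /\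
    (forall x x', (forall j, j < k -> x j = x' j) -> f x = f x').
Proof.
  intros Hk; revert y; induction Hk as [|k Hk IH]; intros y Hn Hy.
  - exists (fun x : nat -> bool => if x 0 then y else e * y); split; [ | split; [ | split]].
    + apply (@inM_gen T mul n _ 0); [lia | exact I].
    + intros x Hx; rewrite Hx; auto.
    + intros x j Hj Hx; replace j with 0 in Hx by lia; rewrite Hx.
      exists e; rewrite assoc, ee; auto.
    + intros x x' Hx; rewrite (Hx 0); auto.
  - apply inSm_succ in Hy; auto; destruct Hy as (y' & s & Hy & ->).
    destruct (IH y') as (f & Mf & H1 & H0 & Hd); [lia | auto | ].
    exists (fun x => f x * (if x k then s else e * (y' * s))); split; [ | split; [ | split]].
    + apply inM_mul; auto; apply (@inM_gen T mul n _ k); [lia | exact I].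
    + intros x Hx; rewrite H1, Hx; auto.
    + intros x j Hj Hx; destruct (x k) eqn:Ek.
      * destruct (H0 x j) as [p Ep]; auto.
        { destruct (Nat.eq_dec j k); [congruence | lia]. }
        exists p; rewrite Ep, !assoc; auto.
      * exists (f x); auto.
    + intros x x' Hx; rewrite (Hx k), (Hd x x'); auto.
Qed.

(** A right identity [t] of [e * y], inserted before the last letter, is unnoticed as soon as one of
    the first [d] coordinates is 0. The term condition gives yts = ys, and yts lies in [K]. *)
Lemma supernilpotent_extension : sg_supernilpotent mul -> nilpotent_extension mul K.
Proof.
  intros [d Hd]; exists (d + 1); split; [lia | intros z Hz].
  (* For [d = 0] the premise of the unary term condition is vacuous, so every element equals [e]. *)
  destruct (Nat.eq_dec d 0) as [-> | Hd0].
  { replace z with e; [apply K_e | ].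
    apply (proj1 (Hd e z)); intros de Hde HT.
    assert (H := HT (fun x : nat -> bool => if x 0 then z else e)).
    apply H; [apply (@inM_gen T mul 1 _ 0); [auto | exact I] | ].
    intros x (j & Hj & _); simpl in Hj; lia. }
  rewrite Nat.add_1_r in Hz; apply inSm_succ in Hz; [ | lia].
  destruct Hz as (y & s & Hy & ->).
  destruct (@power_inM (d + 1) d y) as (f & Mf & H1 & H0 & Hf); auto; [lia | lia | ].
  assert (P : e * y * ll (e * y) = e * y) by (apply mul_ll, K_r, K_e).
  set (t := ll (e * y)) in *.
  assert (Kt : K t) by (apply K_ll, K_r, K_e).
  assert (H : ncomm mul (d + 1) (fun _ => @total_rel T) (y * (t * s)) (y * s)).
  { assert (H := @ncomm_TC T mul (d + 1) (fun _ => @total_rel T)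
      (fun x => f x * (if x d then s else t * s))).
    unfold app_last in H; rewrite Nat.add_sub, Nat.eqb_refl in H.
    assert (E : forall b, f (fun j => if Nat.eqb j d then b else all_ones j) = y).
    { intros b; apply H1; intros j Hj; destruct (Nat.eqb_spec j d); [lia | auto]. }
    rewrite !E in H; apply H.
    - apply inM_mul; auto; apply (@inM_gen T mul (d + 1) _ d); [lia | exact I].
    - intros x (j & Hj & Hx).
      rewrite (Hf (fun j => if Nat.eqb j d then true else x j)
        (fun j => if Nat.eqb j d then false else x j)).
      + destruct (H0 (fun j => if Nat.eqb j d then false else x j) j) as [p ->].
        * lia.
        * destruct (Nat.eqb j d); auto.
        * replace (p * (e * y) * (t * s)) with (p * (e * y) * s);
            [apply (proj1 (ncomm_congruence mul _ _)) | ].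
          rewrite <- P at 1; rewrite !assoc; auto.
      + intros i Hi; destruct (Nat.eqb_spec i d); [lia | auto]. }
  apply (proj1 (Hd _ _)) in H; rewrite <- H; apply K_l, K_r; auto.
Qed.

Lemma Hcl_subgroup_of : subgroup_of mul K Hcl e.
Proof. split; [exact HG | intros x []; auto]. Qed.

End CompletelySimple.

Theorem theorem1p1 (T : Type) (mul : T -> T -> T)
  (assoc : forall x y z, mul x (mul y z) = mul (mul x y) z)
  (K : T -> Prop) (HK : completely_simple_ideal mul K) :
  (sg_solvable mul <->
     nilpotent_extension mul K /\
     (forall G e, subgroup_of mul K G e -> group_solvable mul G e))
  /\
  ((sg_left_nilpotent mul <-> sg_right_nilpotent mul) /\
   (sg_right_nilpotent mul <-> sg_supernilpotent mul) /\
   (sg_supernilpotent mul <->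
      nilpotent_extension mul K /\
      (forall G e, subgroup_of mul K G e -> group_nilpotent mul G e))).
Proof.
  destruct HK as (HI & HS & e & He).
  assert (Hsub := Hcl_subgroup_of assoc HI HS He).
  set (P := nilpotent_extension mul K /\
      (forall G e, subgroup_of mul K G e -> group_nilpotent mul G e)).
  assert (Hl : sg_left_nilpotent mul -> P).
  { intros H; split; [apply (left_nilpotent_extension assoc HI HS He H) | ].
    intros G e' [HG _]; destruct H as [d Hd]; exists d; intros z Hz.
    apply (proj1 (Hd _ _)); rewrite <- series_lcs.
    apply (lower_central_kernel assoc HG false d z Hz). }
  assert (Hr : sg_right_nilpotent mul -> P).
  { intros H; split; [apply (right_nilpotent_extension assoc HI HS He H) | ].
    intros G e' [HG _]; destruct H as [d Hd]; exists d; intros z Hz.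
    apply (proj1 (Hd _ _)); rewrite <- series_rcs.
    apply (lower_central_kernel assoc HG true d z Hz). }
  assert (Hs : sg_supernilpotent mul -> P).
  { intros H; split; [apply (supernilpotent_extension assoc HI HS He H) | ].
    intros G e' [HG _]; apply (supernilpotent_group assoc HG H). }
  (* The converses apply the hypothesis on subgroups to eKe, whose series gives the last part of the
     descent. *)
  assert (Hl' : P -> sg_left_nilpotent mul).
  { intros [Hn HG]; destruct (HG _ _ Hsub) as [k Hk].
    destruct (reaches_trivial (bl := false) (br := true) assoc HI HS He Hk) as [d Hd].
    - apply (lower_central_reaches assoc HI HS He); auto.
    - exists d; rewrite <- series_lcs; auto. }
  assert (Hr' : P -> sg_right_nilpotent mul).
  { intros [Hn HG]; destruct (HG _ _ Hsub) as [k Hk].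
    destruct (reaches_trivial (bl := true) (br := false) assoc HI HS He Hk) as [d Hd].
    - apply (lower_central_reaches assoc HI HS He); auto.
    - exists d; rewrite <- series_rcs; auto. }
  assert (Hs' : P -> sg_supernilpotent mul).
  { intros [Hn HG]; apply (supernilpotent_of_extension assoc HI HS He Hn (HG _ _ Hsub)). }
  split; [split | tauto].
  - intros H; split; [apply (solvable_extension assoc HI HS He H) | ].
    intros G e' [HG _]; destruct H as [d Hd]; exists d; intros z Hz.
    apply (proj1 (Hd _ _)); rewrite <- series_derived.
    apply (derived_series_kernel assoc HG d z Hz).
  - intros [Hn HG]; destruct (HG _ _ Hsub) as [k Hk].
    destruct (reaches_trivial (bl := true) (br := true) assoc HI HS He Hk) as [d Hd].
    + apply (derived_reaches assoc HI HS He); auto.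
    + exists d; rewrite <- series_derived; auto.
Qed.
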